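(* Let $d\ge 3$ be an odd integer. The rigid kernel of the group $G_d$ is neither torsion nor torsion-free.
   Context: Let $d\ge 3$ be odd and $X=\{1,\dots,d\}$. Let $T$ be the $d$-regular rooted tree whose vertex set is the set $X^*$ of finite words over $X$, with root the empty word, the children of $u$ being $ux$, $x\in X$; $X^k$ is the $k$-th level. $\mathrm{Aut}(T)$ is the group of root-preserving graph automorphisms of $T$, with product $gh(u)=h(g(u))$ and identity $e$. For $g\in\mathrm{Aut}(T)$ and $u\in X^*$, the section $g|_u\in\mathrm{Aut}(T)$ is determined by $g(uv)=g(u)\,g|_u(v)$ for all $v\in X^*$. The wreath recursion of $g$ is $g=(g|_1,\dots,g|_d)\lambda_g$, where $\lambda_g\in S_d$ is the permutation induced by $g$ on $X$; it determines $g$. The group $G_d\le \mathrm{Aut}(T)$ is generated by $A=\{a_1,\dots,a_d\}$, defined recursively by: for $1\le i\le d-1$, $\lambda_{a_i}=(i\ \,i+1)$, $a_i|_i=a_i$, $a_i|_{i+1}=a_{i+1}$, and $a_i|_x=e$ for all other $x\in X$; and $\lambda_{a_d}=(d\ 1)$, $a_d|_1=a_1$, $a_d|_d=a_d$, and $a_d|_x=e$ for all other $x\in X$. For $G\le\mathrm{Aut}(T)$, $\mathrm{St}_{G}(\widehat{k})$ is the subgroup of elements of $G$ fixing every vertex of $X^k$. For a vertex $u$, $\mathrm{Rist}_{G}(u)$ is the subgroup of elements of $G$ fixing every vertex not of the form $uv$ with $v\in X^*$; $\mathrm{Rist}_{G}(\widehat{k})$ is the subgroup generated by all $\mathrm{Rist}_{G}(u)$,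 $u\in X^k$. For a branch group $G$ (level-transitive with all $\mathrm{Rist}_G(\widehat{k})$ of finite index; $G_d$ is such a group), put $\overline{G}=\varprojlim_{k\ge1} G/\mathrm{St}_G(\widehat{k})$ and $\widetilde{G}=\varprojlim_{k\ge1} G/\mathrm{Rist}_G(\widehat{k})$. The rigid kernel of $G$ is the kernel of the natural surjection $\widetilde{G}\to\overline{G}$; it equals $\varprojlim_{k\ge 1}\mathrm{St}_G(\widehat{k})/\mathrm{Rist}_G(\widehat{k})$, the maps being induced by the inclusions $\mathrm{St}_G(\widehat{k+p})\hookrightarrow\mathrm{St}_G(\widehat{k})$ and $\mathrm{Rist}_G(\widehat{k+p})\hookrightarrow\mathrm{Rist}_G(\widehat{k})$. *)

(* Defs.v *)
From HB Require Import structures.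
From mathcomp Require Import all_boot perm.
From mathcomp Require Import boolp classical_sets.

Set Implicit Arguments.
Unset Strict Implicit.
Unset Printing Implicit Defensive.

Local Open Scope classical_set_scope.
Local Open Scope quotient_scope.
Local Open Scope group_scope.

Definition subgroup_set (gT : groupType) (H : set gT) : Prop :=
  [/\ H 1, forall x y, H x -> H y -> H (x * y) & forall x, H x -> H x^-1].

Record subgroup (gT : groupType) := Subgroup {
  sgset :> set gT;
  sgsetP : subgroup_set sgset
}.

Definition generated (gT : groupType) (S : set gT) : set gT :=
  smallest (@subgroup_set gT) S.

Lemma generated_subgroup (gT : groupType) (S : set gT) :
  subgroup_set (generated S).
Proof.
split=> [A [[]]//|x y Hx Hy A AS|x Hx A AS].
  by have [[_ AM _] _] := AS; apply: AM; [apply: Hx|apply: Hy].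
by have [[_ _ AV] _] := AS; apply: AV; apply: Hx.
Qed.

Section GroupOf.
Variables (gT : groupType) (H : subgroup gT).

Record group_of := GroupOf {
  group_val : gT;
  group_valP : group_val \in sgset H
}.

HB.instance Definition _ := [isSub for group_val].
HB.instance Definition _ := [Choice of group_of by <:].

Lemma subgroup_closed : group_closed (fun x : gT => x \in sgset H).
Proof.
have [H1 HM HV] := sgsetP H; split; first exact/mem_set.
move=> x y /set_mem Hx /set_mem Hy; apply/mem_set; apply: HM => //.
exact: HV.
Qed.

HB.instance Definition _ :=
  SubChoice_isSubGroup.Build gT _ group_of subgroup_closed.

End GroupOf.

Record normal_subgroup (gT : groupType) := NormalSubgroup {
  nsubgroup :> subgroup gT;
  normalP : forall x g : gT, sgset nsubgroup x -> sgset nsubgroup (x ^ g)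
}.

Section Quotient.
Variables (gT : groupType) (N : normal_subgroup gT).

Definition coset_eq (x y : gT) : bool := `[< sgset N (x^-1 * y) >].

Lemma coset_eq_refl : reflexive coset_eq.
Proof. by move=> x; apply/asboolP; rewrite mulVg; case: (sgsetP N). Qed.

Lemma coset_eq_sym : symmetric coset_eq.
Proof.
have [_ _ NV] := sgsetP N; move=> x y.
by apply/asboolP/asboolP => /NV; rewrite invgM invgK.
Qed.

Lemma coset_eq_trans : transitive coset_eq.
Proof.
have [_ NM _] := sgsetP N; move=> y x z /asboolP xy /asboolP yz.
by apply/asboolP; move: (NM _ _ xy yz); rewrite -mulgA mulVKg.
Qed.

Canonical coset_equiv : equiv_rel gT :=
  EquivRel coset_eq coset_eq_refl coset_eq_sym coset_eq_trans.

Definition quotient_group : Type := {eq_quot coset_equiv}.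

HB.instance Definition _ := Choice.on quotient_group.
HB.instance Definition _ := EqQuotient.on quotient_group.

Lemma quotientP (x y : gT) :
  \pi_quotient_group x = \pi_quotient_group y <-> sgset N (x^-1 * y).
Proof. by split=> [/eqmodP /asboolP|?]; [|apply/eqmodP/asboolP]. Qed.

Definition quotient_mul (c c' : quotient_group) : quotient_group :=
  \pi_quotient_group (repr c * repr c').
Definition quotient_one : quotient_group := \pi_quotient_group 1.
Definition quotient_inv (c : quotient_group) : quotient_group :=
  \pi_quotient_group (repr c)^-1.

Lemma repr_pi (x : gT) : sgset N ((repr (\pi_quotient_group x))^-1 * x).
Proof. by apply/quotientP; rewrite reprK. Qed.

Lemma quotient_piM (x y : gT) :
  quotient_mul (\pi_quotient_group x) (\pi_quotient_group y) =
  \pi_quotient_group (x * y).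
Proof.
have [_ NM _] := sgsetP N; apply/quotientP.
set x' := repr _; set y' := repr _.
have -> : (x' * y')^-1 * (x * y) = (x'^-1 * x) ^ y' * (y'^-1 * y).
  by rewrite invgM conjgE !mulgA mulgK.
by apply: NM; [apply: normalP; apply: repr_pi | apply: repr_pi].
Qed.

Lemma quotient_piV (x : gT) :
  quotient_inv (\pi_quotient_group x) = \pi_quotient_group x^-1.
Proof.
have [_ _ NV] := sgsetP N; apply/quotientP; set x' := repr _.
have -> : (x'^-1)^-1 * x^-1 = (x'^-1 * x)^-1 ^ x'^-1.
  by rewrite invgM conjgE !invgK !mulgA mulgK.
by apply: normalP; apply: NV; apply: repr_pi.
Qed.

Lemma quotient_mulA : associative quotient_mul.
Proof.
elim/quotW=> a; elim/quotW=> b; elim/quotW=> c.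
rewrite (quotient_piM b c) (quotient_piM a b) (quotient_piM a (b * c)).
by rewrite (quotient_piM (a * b) c) mulgA.
Qed.

Lemma quotient_mul1 : left_id quotient_one quotient_mul.
Proof. by elim/quotW=> a; rewrite quotient_piM mul1g. Qed.

Lemma quotient_mulr1 : right_id quotient_one quotient_mul.
Proof. by elim/quotW=> a; rewrite quotient_piM mulg1. Qed.

Lemma quotient_mulV : left_inverse quotient_one quotient_inv quotient_mul.
Proof. by elim/quotW=> a; rewrite quotient_piV quotient_piM mulVg. Qed.

Lemma quotient_mulrV : right_inverse quotient_one quotient_inv quotient_mul.
Proof. by elim/quotW=> a; rewrite quotient_piV quotient_piM mulgV. Qed.

HB.instance Definition _ := isGroup.Build quotient_group quotient_mulA
  quotient_mul1 quotient_mulr1 quotient_mulV quotient_mulrV.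

Lemma piM (x y : gT) :
  \pi_quotient_group (x * y) = \pi_quotient_group x * \pi_quotient_group y
    :> quotient_group.
Proof. by rewrite -quotient_piM. Qed.

Lemma piV (x : gT) :
  \pi_quotient_group x^-1 = (\pi_quotient_group x)^-1 :> quotient_group.
Proof. by rewrite -quotient_piV. Qed.

End Quotient.

(* The natural map from G/M to G/N, which is only meaningful for M <= N; see
   quotient_mapE *)
Definition quotient_map (gT : groupType) (M N : normal_subgroup gT)
  (c : quotient_group M) : quotient_group N :=
  \pi_(quotient_group N) (repr c).

Section QuotientMap.
Variables (gT : groupType) (M N : normal_subgroup gT).
Hypothesis MN : M `<=` N.

Lemma quotient_mapE (x : gT) :
  quotient_map N (\pi_(quotient_group M) x) = \pi_(quotient_group N) x.
Proof. by apply/quotientP; apply: MN; apply: repr_pi. Qed.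

Lemma quotient_mapM : {morph @quotient_map gT M N : c c' / c * c'}.
Proof.
elim/quotW=> a; elim/quotW=> b; rewrite -piM (quotient_mapE (a * b)).
by rewrite (quotient_mapE a) (quotient_mapE b) piM.
Qed.

Lemma quotient_map1 : quotient_map N (1 : quotient_group M) = 1.
Proof. exact: quotient_mapE. Qed.

Lemma quotient_mapV : {morph @quotient_map gT M N : c / c^-1}.
Proof.
by elim/quotW=> a; rewrite -piV (quotient_mapE a^-1) (quotient_mapE a) piV.
Qed.

End QuotientMap.

Lemma quotient_map_comp (gT : groupType) (L M N : normal_subgroup gT)
    (LM : L `<=` M) (MN : M `<=` N) (c : quotient_group L) :
  quotient_map N (quotient_map M c) = quotient_map N c.
Proof.
elim/quotW: c => c; rewrite (quotient_mapE LM c) (quotient_mapE MN c).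
by rewrite (quotient_mapE (subset_trans LM MN) c).
Qed.

Record chain (gT : groupType) := Chain {
  chain_term :> nat -> normal_subgroup gT;
  chainP : forall k p, chain_term (k + p) `<=` chain_term k
}.

Section InverseLimit.
Variables (gT : groupType) (N : chain gT).

Record invlim := InvLim {
  invlim_term :> forall k, quotient_group (N k);
  invlimP : forall k p,
    quotient_map (N k) (invlim_term (k + p)) = invlim_term k
}.

HB.instance Definition _ := gen_eqMixin invlim.
HB.instance Definition _ := gen_choiceMixin invlim.

Lemma invlim_ext (x y : invlim) : (forall k, x k = y k) -> x = y.
Proof.
case: x y => [x xP] [y yP] /= xy.
have {}xy : x = y by exact: functional_extensionality_dep.
by subst y; congr InvLim; apply: Prop_irrelevance.
Qed.

Lemma invlim_mul_subproof (x y : invlim) k p :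
  quotient_map (N k) (x (k + p)%N * y (k + p)%N) = x k * y k.
Proof. by rewrite quotient_mapM ?invlimP //; apply: chainP. Qed.

Lemma invlim_one_subproof k p :
  quotient_map (N k) (1 : quotient_group (N (k + p)%N)) = 1.
Proof. by apply: quotient_map1; apply: chainP. Qed.

Lemma invlim_inv_subproof (x : invlim) k p :
  quotient_map (N k) (x (k + p)%N)^-1 = (x k)^-1.
Proof. by rewrite quotient_mapV ?invlimP //; apply: chainP. Qed.

Definition invlim_mul (x y : invlim) : invlim :=
  InvLim (invlim_mul_subproof x y).
Definition invlim_one : invlim := InvLim invlim_one_subproof.
Definition invlim_inv (x : invlim) : invlim := InvLim (invlim_inv_subproof x).

Lemma invlim_mulA : associative invlim_mul.
Proof. by move=> x y z; apply: invlim_ext => k /=; apply: mulgA. Qed.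

Lemma invlim_mul1 : left_id invlim_one invlim_mul.
Proof. by move=> x; apply: invlim_ext => k /=; apply: mul1g. Qed.

Lemma invlim_mulr1 : right_id invlim_one invlim_mul.
Proof. by move=> x; apply: invlim_ext => k /=; apply: mulg1. Qed.

Lemma invlim_mulV : left_inverse invlim_one invlim_inv invlim_mul.
Proof. by move=> x; apply: invlim_ext => k /=; apply: mulVg. Qed.

Lemma invlim_mulrV : right_inverse invlim_one invlim_inv invlim_mul.
Proof. by move=> x; apply: invlim_ext => k /=; apply: mulgV. Qed.

HB.instance Definition _ := isGroup.Build invlim invlim_mulA
  invlim_mul1 invlim_mulr1 invlim_mulV invlim_mulrV.

End InverseLimit.

Section InverseLimitMap.
Variables (gT : groupType) (M N : chain gT).
Hypothesis MN : forall k, M k `<=` N k.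

Lemma invlim_map_subproof (x : invlim M) k p :
  quotient_map (N k) (quotient_map (N (k + p)) (x (k + p)%N)) =
  quotient_map (N k) (x k).
Proof.
rewrite quotient_map_comp; [|exact: MN|exact: chainP].
rewrite -(invlimP x k p) quotient_map_comp //; exact: chainP.
Qed.

Definition invlim_map (x : invlim M) : invlim N :=
  InvLim (invlim_map_subproof x).

Lemma invlim_mapM : {morph invlim_map : x y / x * y}.
Proof. by move=> x y; apply: invlim_ext => k /=; apply: quotient_mapM. Qed.

End InverseLimitMap.

Definition torsion (gT : groupType) (H : set gT) : Prop :=
  forall x, H x -> exists2 n, (0 < n)%N & x ^+ n = 1.

Definition torsion_free (gT : groupType) (H : set gT) : Prop :=
  forall x, H x -> x <> 1 -> forall n, (0 < n)%N -> x ^+ n <> 1.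

(* The regular rooted tree with vertices the words over 'I_d, the letter
   x in {1, ..., d} being encoded as x - 1 *)

Section Tree.
Variable d : nat.
Implicit Types (u v w : seq 'I_d) (f g : seq 'I_d -> seq 'I_d).

Definition adjacent u v : Prop :=
  (exists x, v = rcons u x) \/ (exists x, u = rcons v x).

Definition tree_automorphism f : Prop :=
  [/\ bijective f, f [::] = [::]
    & forall u v, adjacent (f u) (f v) <-> adjacent u v].

Record Aut_tree := AutTree {
  aut_fun :> seq 'I_d -> seq 'I_d;
  autP : tree_automorphism aut_fun
}.

HB.instance Definition _ := gen_eqMixin Aut_tree.
HB.instance Definition _ := gen_choiceMixin Aut_tree.

Lemma aut_ext (g h : Aut_tree) : g =1 h -> g = h.
Proof.
case: g h => [g gP] [h hP] /= /funext gh.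
by subst h; congr AutTree; apply: Prop_irrelevance.
Qed.

Lemma aut_inv_exists (g : Aut_tree) : exists h, cancel g h /\ cancel h g.
Proof. by have [[h gK hK] _ _] := autP g; exists h. Qed.

Definition aut_inv_fun (g : Aut_tree) : seq 'I_d -> seq 'I_d :=
  sval (cid (aut_inv_exists g)).

Lemma aut_invK (g : Aut_tree) : cancel g (aut_inv_fun g).
Proof. by rewrite /aut_inv_fun; case: cid => h []. Qed.

Lemma autK_inv (g : Aut_tree) : cancel (aut_inv_fun g) g.
Proof. by rewrite /aut_inv_fun; case: cid => h []. Qed.

Lemma aut_one_subproof : tree_automorphism id.
Proof. by split=> //; exists id. Qed.

(* Automorphisms act on the right: (g * h) u = h (g u) *)
Lemma aut_mul_subproof (g h : Aut_tree) : tree_automorphism (h \o g).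
Proof.
have [gb g0 gA] := autP g; have [hb h0 hA] := autP h.
split; [exact: bij_comp|by rewrite /= g0 h0|move=> u v /=].
by rewrite hA gA.
Qed.

Lemma aut_inv_subproof (g : Aut_tree) : tree_automorphism (aut_inv_fun g).
Proof.
have [gb g0 gA] := autP g; split.
- by exists g; [apply: autK_inv|apply: aut_invK].
- by rewrite -{1}g0 aut_invK.
- by move=> u v; rewrite -gA !autK_inv.
Qed.

Definition aut_one : Aut_tree := AutTree aut_one_subproof.
Definition aut_mul (g h : Aut_tree) : Aut_tree :=
  AutTree (aut_mul_subproof g h).
Definition aut_inv (g : Aut_tree) : Aut_tree := AutTree (aut_inv_subproof g).

Lemma aut_mulA : associative aut_mul.
Proof. by move=> x y z; apply: aut_ext. Qed.
Lemma aut_mul1 : left_id aut_one aut_mul.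
Proof. by move=> x; apply: aut_ext. Qed.
Lemma aut_mulr1 : right_id aut_one aut_mul.
Proof. by move=> x; apply: aut_ext. Qed.
Lemma aut_mulV : left_inverse aut_one aut_inv aut_mul.
Proof. by move=> x; apply: aut_ext => u /=; apply: autK_inv. Qed.
Lemma aut_mulrV : right_inverse aut_one aut_inv aut_mul.
Proof. by move=> x; apply: aut_ext => u /=; apply: aut_invK. Qed.

HB.instance Definition _ := isGroup.Build Aut_tree aut_mulA
  aut_mul1 aut_mulr1 aut_mulV aut_mulrV.

Lemma size_adjacent u v :
  adjacent u v -> size v = (size u).+1 \/ size u = (size v).+1.
Proof. by case=> [[x ->]|[x ->]]; rewrite size_rcons; [left|right]. Qed.

Lemma aut_rcons (g : Aut_tree) u x :
  size (g u) = size u /\ exists y, g (rcons u x) = rcons (g u) y.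
Proof.
have [gb g0 gA] := autP g.
elim/last_ind: u x => [|u z IHu] x.
  have /gA : adjacent [::] [:: x] by left; exists x.
  rewrite g0; case=> [[y gx]|[y /(congr1 size)]]; last by rewrite size_rcons.
  by split=> //; exists y.
have [su [y guz]] := IHu z.
rewrite guz !size_rcons su; split=> //.
have /gA : adjacent (rcons u z) (rcons (rcons u z) x) by left; exists x.
rewrite guz => -[[t ->]|[t /rcons_inj [gu _]]]; first by exists t.
have := bij_inj gb gu => /(congr1 size); rewrite !size_rcons.
by move/eqP; rewrite ltn_eqF.
Qed.

Lemma size_aut (g : Aut_tree) u : size (g u) = size u.
Proof.
elim/last_ind: u => [|u x _]; first by have [_ -> _] := autP g.
by have [su [y ->]] := aut_rcons g u x; rewrite !size_rcons su.
Qed.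

Lemma prefix_aut (g : Aut_tree) u w : prefix (g u) (g w) = prefix u w.
Proof.
have imp (h : Aut_tree) s t : prefix s t -> prefix (h s) (h t).
  case/prefixP=> v ->; elim/last_ind: v => [|v x IHv].
    by rewrite cats0 prefix_refl.
  rewrite -rcons_cat; have [_ [y ->]] := aut_rcons h (s ++ v) x.
  by apply: prefix_trans IHv _; rewrite prefix_rcons.
apply/idP/idP; last exact: imp.
by move/(imp (g^-1)); rewrite /= !aut_invK.
Qed.

End Tree.

(* For G <= Aut(T), St_G(k) and Rist_G(u) are defined as subgroups of the group
   G itself rather than of Aut(T) *)

Section Stabilizers.
Variables (d : nat) (G : subgroup (Aut_tree d)).

Definition act (g : group_of G) : seq 'I_d -> seq 'I_d := aut_fun (val g).

Definition St_set (k : nat) : set (group_of G) :=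
  [set g | forall u, size u = k -> act g u = u].

Definition Rist_set (u : seq 'I_d) : set (group_of G) :=
  [set g | forall w, ~~ prefix u w -> act g w = w].

Definition Rist_level_set (k : nat) : set (group_of G) :=
  generated (\bigcup_(u in [set u | size u = k]) Rist_set u).

Lemma act1 u : act 1 u = u.
Proof. by []. Qed.

Lemma actM (x y : group_of G) u : act (x * y) u = act y (act x u).
Proof. by []. Qed.

Lemma actK (x : group_of G) : cancel (act x) (act x^-1).
Proof. exact: aut_invK. Qed.

Lemma actKV (x : group_of G) : cancel (act x^-1) (act x).
Proof. exact: autK_inv. Qed.

Lemma actJ_fix (x g : group_of G) w :
  act x (act g^-1 w) = act g^-1 w -> act (x ^ g) w = w.
Proof. by rewrite conjgE !actM => ->; apply: actKV. Qed.

Lemma St_subgroup k : subgroup_set (St_set k).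
Proof.
split=> [//|x y xk yk u su|x xk u su]; first by rewrite actM xk // yk.
by rewrite -{1}(xk u su) actK.
Qed.

Lemma St_normal k (x g : group_of G) : St_set k x -> St_set k (x ^ g).
Proof. by move=> xk u su; apply: actJ_fix; apply: xk; rewrite size_aut. Qed.

Definition St k : normal_subgroup (group_of G) :=
  @NormalSubgroup _ (Subgroup (St_subgroup k)) (@St_normal k).

Lemma Rist_subgroup u : subgroup_set (Rist_set u).
Proof.
split=> [//|x y xu yu w uw|x xu w uw]; first by rewrite actM xu // yu.
by rewrite -{1}(xu w uw) actK.
Qed.

Definition Rist u : subgroup (group_of G) := Subgroup (Rist_subgroup u).

Lemma RistJ u (x g : group_of G) : Rist_set u x -> Rist_set (act g u) (x ^ g).
Proof.
move=> xu w uw; apply: actJ_fix; apply: xu.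
by move: uw; rewrite -{1}(actKV g w) prefix_aut.
Qed.

Lemma Rist_level_normal k (x g : group_of G) :
  Rist_level_set k x -> Rist_level_set k (x ^ g).
Proof.
have [R1 RM RV] :=
  generated_subgroup (\bigcup_(u in [set u | size u = k]) Rist_set u).
pose A := [set y : group_of G | Rist_level_set k (y ^ g)].
apply: (@smallest_sub _ _ _ A).
- split=> [|y z Ay Az|y Ay]; rewrite /A /= ?conj1g //.
    by rewrite conjMg; apply: RM.
  by rewrite conjVg; apply: RV.
- move=> y [u su yu]; apply: sub_gen_smallest; exists (act g u).
    by rewrite /= size_aut.
  exact: RistJ.
Qed.

Definition Rist_level k : normal_subgroup (group_of G) :=
  @NormalSubgroup _ (Subgroup (generated_subgroup _)) (@Rist_level_normal k).

Lemma St_anti k p : St (k + p) `<=` St k.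
Proof.
move=> x xkp u su.
case: p xkp => [|p xkp]; first by rewrite addn0; apply.
case: u su => [_|i u su]; first by case: (autP (val x)).
move: (i :: u) su => {}u su.
have /prefixP[w e] : prefix (act x u) (act x (u ++ nseq p.+1 i)).
  by rewrite prefix_aut prefix_prefix.
move: e; rewrite xkp; last by rewrite size_cat size_nseq su.
by move/eqP; rewrite eqseq_cat ?size_aut // => /andP[/eqP].
Qed.

Lemma Rist_level_anti k p : Rist_level (k + p) `<=` Rist_level k.
Proof.
apply: smallest_sub; first exact: generated_subgroup.
move=> x [u su xu]; apply: sub_gen_smallest; exists (take k u).
  by rewrite /= size_takel // su leq_addr.
move=> w uw; apply: xu; apply: contra uw.
by apply: prefix_trans; apply: prefix_take.
Qed.

Lemma Rist_level_sub_St k : Rist_level k `<=` St k.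
Proof.
apply: smallest_sub; first exact: St_subgroup.
move=> x [u su xu] v sv.
have fix_ne w : size w = k -> w <> u -> act x w = w.
  move=> sw wu; apply: xu; apply/negP => /prefixP[t e]; apply: wu.
  move: sw; rewrite e size_cat su => /eqP.
  by rewrite -[X in _ == X]addn0 eqn_add2l size_eq0 => /eqP ->; rewrite cats0.
have [vu|/eqP vu] := eqVneq v u; last exact: fix_ne.
have [//|/eqP xv] := eqVneq (act x v) v.
have [xb _ _] := autP (val x).
by apply: (bij_inj xb); apply: fix_ne; [rewrite size_aut|rewrite -vu].
Qed.

(* The inverse limits run over the levels k >= 1, hence the shift *)
Definition St_chain : chain (group_of G) :=
  @Chain _ (fun k => St k.+1) (fun k p => @St_anti k.+1 p).

Definition Rist_chain : chain (group_of G) :=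
  @Chain _ (fun k => Rist_level k.+1) (fun k p => @Rist_level_anti k.+1 p).

Definition rigid_kernel : set (invlim Rist_chain) :=
  [set x | @invlim_map _ Rist_chain St_chain
             (fun k => @Rist_level_sub_St k.+1) x = 1].

End Stabilizers.

Arguments St {d} G k.
Arguments Rist {d} G u.
Arguments Rist_level {d} G k.
Arguments rigid_kernel {d} G _.

(* ordS is the cyclic successor i |-> i + 1 mod d, so the clause for a_d is the
   same as the one for a_1, ..., a_{d-1} *)
Fixpoint gen_fun (d : nat) (i : 'I_d) (u : seq 'I_d) {struct u} : seq 'I_d :=
  if u is x :: v then
    tperm i (ordS i) x ::
      (if x == i then gen_fun i v
       else if x == ordS i then gen_fun (ordS i) v else v)
  else [::].

Fixpoint gen_inv (d : nat) (i : 'I_d) (u : seq 'I_d) {struct u} : seq 'I_d :=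
  if u is y :: v then
    let x := tperm i (ordS i) y in
    x :: (if x == i then gen_inv i v
          else if x == ordS i then gen_inv (ordS i) v else v)
  else [::].

Lemma gen_funK (d : nat) (i : 'I_d) : cancel (gen_fun i) (gen_inv i).
Proof.
move=> u; elim: u i => //= x v IHv i; rewrite tpermK; congr (_ :: _).
by case: eqP => // _; case: eqP.
Qed.

Lemma gen_invK (d : nat) (i : 'I_d) : cancel (gen_inv i) (gen_fun i).
Proof.
move=> u; elim: u i => //= x v IHv i; rewrite tpermK; congr (_ :: _).
by case: eqP => // _; case: eqP.
Qed.

Lemma gen_fun_rcons (d : nat) (i : 'I_d) u x :
  exists y, gen_fun i (rcons u x) = rcons (gen_fun i u) y.
Proof.
elim: u i => [|z u IHu] i /=.
  by exists (tperm i (ordS i) x); rewrite !if_same.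
case: ifP => _; first by have [y ->] := IHu i; exists y.
by case: ifP => _; [have [y ->] := IHu (ordS i); exists y|exists x].
Qed.

Lemma gen_inv_rcons (d : nat) (i : 'I_d) u x :
  exists y, gen_inv i (rcons u x) = rcons (gen_inv i u) y.
Proof.
elim: u i => [|z u IHu] i /=.
  by exists (tperm i (ordS i) x); rewrite !if_same.
case: ifP => _; first by have [y ->] := IHu i; exists y.
by case: ifP => _; [have [y ->] := IHu (ordS i); exists y|exists x].
Qed.

Lemma gen_automorphism (d : nat) (i : 'I_d) : tree_automorphism (gen_fun i).
Proof.
have adj (f : seq 'I_d -> seq 'I_d) :
    (forall u x, exists y, f (rcons u x) = rcons (f u) y) ->
  forall u v, adjacent u v -> adjacent (f u) (f v).
  move=> fr u v [] [x ->].
    by have [y ->] := fr u x; left; exists y.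
  by have [y ->] := fr v x; right; exists y.
split=> //; first by exists (gen_inv i); [apply: gen_funK|apply: gen_invK].
move=> u v; split; last exact/adj/gen_fun_rcons.
by move/(adj _ (gen_inv_rcons i)); rewrite !gen_funK.
Qed.

Definition gen (d : nat) (i : 'I_d) : Aut_tree d :=
  AutTree (gen_automorphism i).

Definition G_ (d : nat) : subgroup (Aut_tree d) :=
  Subgroup (generated_subgroup (range (@gen d))).

(* Main.v *)
Require Import Defs.
From mathcomp Require Import all_boot all_algebra perm.
From mathcomp Require Import boolp classical_sets.
From mathcomp Require Import zify ring.

(** Indices and letters are read modulo d. Write |g| for the exponent sum of g
    in the generators a_1, ..., a_d, and (g_1, ..., g_d) for the element fixing
    the first level with these sections. The rigid kernel is governed by |.|
    alone.

    The exponent sum is well defined ([wexpo_relator]). Every a_i has two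
    nontrivial sections, both generators, so the sections of a word at the
    letters have total exponent twice that of the word. Take a shortest relator
    of nonzero exponent, with the largest possible absolute value of the
    exponent. At least two of its sections are as long as itself, which forces
    it to be a power of a single a_i. Its section at the letter i is extremal in
    the same sense, but involves both a_i and a_(i+1), a contradiction. Hence
    |.| is a homomorphism to the integers, the sections of g at the letters have
    total degree 2|g| ([sum_deg_sections]), and |g| is even when g fixes the
    first level ([deg_even]).

    Conversely (p, q, 1, ..., 1), with p and q at any two letters, belongs to
    the group as soon as 4 divides |p| + |q| ([pair_in_G]). Every p extends to
    some such element ([pair_extension]), and commutators of two such elements
    whose supports share one letter show that the set D of the elements p for
    which (1, ..., p, ..., 1) is in the group contains all commutators
    ([branching_commg]). Working modulo D, one finds that (p, p^-1, 1, ..., 1)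
    is in the group ([pair_inverse]); comparing with two explicit elements,
    a_i^2 and [exchange_relation], gives a_i^4 = 1 and a_(i-1) = a_(i+1) modulo
    D. As d is odd, all generators agree modulo D, so D contains every p with
    |p| divisible by 4 ([branching_deg]).

    It follows that an element of St(k), k > 0, lies in Rist(k) if and only if
    the degrees of its sections at level k are divisible by 2^(k+1)
    ([Rist_level_divisible], [divisible_Rist_level]). An element of the rigid
    kernel is thus described by the degrees, modulo 2^(k+1), of sections at the
    vertices of level k, where the degrees at the children of a vertex must add
    up to twice the degree at that vertex. Starting from degrees 2 and -2 at two
    letters, the total 2c required below a vertex of degree c can be shared by
    two children as c + c or concentrated on one as 2c + 0. In the first case
    degrees 2 occur at all levels, and the element has infinite order; in the
    second all degrees at level k are 0, 2^k or -2^k, and the element has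
    order 2. *)

Set Implicit Arguments.
Unset Strict Implicit.
Unset Printing Implicit Defensive.

Import GRing.Theory.

Local Open Scope group_scope.

(** * Sections of tree automorphisms *)

Section Carries.
Variable d : nat.
Implicit Types (g h k : Aut_tree d) (u v w : seq 'I_d) (x y : 'I_d).

(** The relation g(u) = v and g|_u = h; used in place of a section function, it
    makes the cocycle rules below hold without any side condition. *)
Definition carries g u v h : Prop := forall w, g (u ++ w) = v ++ h w.

Lemma aut_nil g : g [::] = [::].
Proof. by case: (autP g). Qed.

Lemma aut_inj g : injective g.
Proof. by case: (autP g) => /bij_inj. Qed.

Lemma autKV g w : g (g^-1 w) = w.
Proof. exact: autK_inv. Qed.

Lemma carries_self g : carries g [::] [::] g.
Proof. by []. Qed.

Lemma carries1 u : carries 1 u u 1.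
Proof. by []. Qed.

Lemma carriesM g g' u v w h h' :
  carries g u v h -> carries g' v w h' -> carries (g * g') u w (h * h').
Proof. by move=> gu g'v t; rewrite /= gu g'v. Qed.

Lemma carriesV g u v h : carries g u v h -> carries g^-1 v u h^-1.
Proof. by move=> gu t; apply: (@aut_inj g); rewrite autKV gu autKV. Qed.

Lemma carriesX g u h n : carries g u u h -> carries (g ^+ n) u u (h ^+ n).
Proof.
move=> gu; elim: n => [|n IHn]; first exact: carries1.
by rewrite !expgS; apply: carriesM IHn.
Qed.

Lemma carries_cat g h k u u' v v' :
  carries g u v h -> carries h u' v' k -> carries g (u ++ u') (v ++ v') k.
Proof. by move=> gu hu t; rewrite -!catA gu hu. Qed.

Lemma carriesE g u v h : carries g u v h -> g u = v.
Proof. by move/(_ [::]); rewrite aut_nil !cats0. Qed.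

Lemma carries_fun g u v v' h h' :
  carries g u v h -> carries g u v' h' -> v = v' /\ h = h'.
Proof.
move=> gu gu'; have vv' : v = v' by rewrite -(carriesE gu) (carriesE gu').
split=> //; apply: aut_ext => w; have := gu w; rewrite gu' vv'.
by move/eqP; rewrite eqseq_cat // eqxx /= => /eqP.
Qed.

Lemma carries_inj g u u' v h h' :
  carries g u v h -> carries g u' v h' -> u = u'.
Proof.
by move=> /carriesE gu /carriesE gu'; apply: (@aut_inj g); rewrite gu.
Qed.

Lemma eq_letters g g' :
    (forall x, exists y h,
      carries g [:: x] [:: y] h /\ carries g' [:: x] [:: y] h) ->
  g = g'.
Proof.
move=> gg'; apply: aut_ext => -[|x w]; first by rewrite !aut_nil.
by have [y [h [gx g'x]]] := gg' x; rewrite (gx w) (g'x w).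
Qed.

(** * Automorphisms fixing the first level *)

Definition diag_fun (h : 'I_d -> Aut_tree d) (u : seq 'I_d) : seq 'I_d :=
  if u is x :: v then x :: h x v else [::].

Lemma diag_automorphism (h : 'I_d -> Aut_tree d) :
  tree_automorphism (diag_fun h).
Proof.
pose h' x := (h x)^-1.
have hK : cancel (diag_fun h) (diag_fun h').
  by case=> //= x v; rewrite aut_invK.
have h'K : cancel (diag_fun h') (diag_fun h).
  by case=> //= x v; rewrite autK_inv.
have adj (f : 'I_d -> Aut_tree d) u v :
    adjacent u v -> adjacent (diag_fun f u) (diag_fun f v).
  have fr w x : exists y, diag_fun f (rcons w x) = rcons (diag_fun f w) y.
    case: w => [|z w] /=; first by exists x; rewrite aut_nil.
    by have [_ [y ->]] := aut_rcons (f z) w x; exists y.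
  case=> [] [x ->].
    by have [y ->] := fr u x; left; exists y.
  by have [y ->] := fr v x; right; exists y.
split=> //; first by exists (diag_fun h').
by move=> u v; split=> [/(adj h')|]; [rewrite !hK|apply: adj].
Qed.

Definition diag (h : 'I_d -> Aut_tree d) := AutTree (diag_automorphism h).

Lemma diag_carries (h : 'I_d -> Aut_tree d) x :
  carries (diag h) [:: x] [:: x] (h x).
Proof. by []. Qed.

Lemma diagP g (h : 'I_d -> Aut_tree d) :
  (forall x, carries g [:: x] [:: x] (h x)) -> g = diag h.
Proof. by move=> gh; apply: eq_letters => x; exists x, (h x). Qed.

Lemma diagM (h h' : 'I_d -> Aut_tree d) :
  diag h * diag h' = diag (fun x => h x * h' x).
Proof.
by apply: diagP => x; exact: carriesM (diag_carries h x) (diag_carries h' x).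
Qed.

Lemma diagV (h : 'I_d -> Aut_tree d) : (diag h)^-1 = diag (fun x => (h x)^-1).
Proof. by apply: diagP => x; exact: carriesV (diag_carries h x). Qed.

Definition at1 x p : 'I_d -> Aut_tree d := fun z => if z == x then p else 1.

Definition at2 x p y q : 'I_d -> Aut_tree d :=
  fun z => if z == x then p else if z == y then q else 1.

Lemma at2_sym x p y q : x != y -> at2 x p y q = at2 y q x p.
Proof.
move=> xy; apply/funext => z; rewrite /at2.
by have [->|//] := eqVneq z x; rewrite (negbTE xy).
Qed.

Lemma at21 x p y : at2 x p y 1 = at1 x p.
Proof. by apply/funext => z; rewrite /at2 /at1 if_same. Qed.

Lemma at12 x y q : x != y -> at2 x 1 y q = at1 y q.
Proof. by move=> xy; rewrite at2_sym // at21. Qed.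

Lemma diag_at2M x p q y p' q' :
  diag (at2 x p y q) * diag (at2 x p' y q') = diag (at2 x (p * p') y (q * q')).
Proof.
rewrite diagM; congr diag; apply/funext => z; rewrite /at2.
by do 2![case: ifP => // _]; rewrite mulg1.
Qed.

Lemma diag_at2V x p y q :
  (diag (at2 x p y q))^-1 = diag (at2 x p^-1 y q^-1).
Proof.
rewrite diagV; congr diag; apply/funext => z; rewrite /at2.
by do 2![case: ifP => // _]; rewrite invg1.
Qed.

Lemma diag_at1M x p q : diag (at1 x p) * diag (at1 x q) = diag (at1 x (p * q)).
Proof. by rewrite -!(at21 _ _ x) diag_at2M mulg1. Qed.

Lemma diag_at1V x p : (diag (at1 x p))^-1 = diag (at1 x p^-1).
Proof. by rewrite -!(at21 _ _ x) diag_at2V invg1. Qed.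

End Carries.

(** * The exponent sum of a word *)

Section OddPolygonGroup.
Variable d : nat.
Hypothesis d_ge3 : 3 <= d.
Implicit Types (g h : Aut_tree d) (x y i : 'I_d).

Notation G := (sgset (G_ d)).

Lemma val_iter_ordS i m : val (iter m (@ordS d) i) = (i + m) %% d.
Proof.
elim: m => [|m IHm] /=; first by rewrite addn0 modn_small.
by rewrite IHm -addn1 modnDml addn1 addnS.
Qed.

Lemma iter_ordS_neq i m n :
  m < n < m + d -> iter n (@ordS d) i != iter m (@ordS d) i.
Proof.
move=> /andP[mn nd]; rewrite -val_eqE /= !val_iter_ordS.
rewrite -(subnKC (ltnW mn)) addnA -{2}[i + m]addn0 eqn_modDl mod0n.
by rewrite modn_small; lia.
Qed.

Lemma ordS_neq i : ordS i != i.
Proof. by apply: (@iter_ordS_neq i 0 1); lia. Qed.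

Lemma ordSS_neq i : ordS (ordS i) != i.
Proof. by apply: (@iter_ordS_neq i 0 2); lia. Qed.

Lemma gen_carries_l i : carries (gen i) [:: i] [:: ordS i] (gen i).
Proof. by move=> w; rewrite /= tpermL eqxx. Qed.

Lemma gen_carries_r i : carries (gen i) [:: ordS i] [:: i] (gen (ordS i)).
Proof. by move=> w; rewrite /= tpermR (negbTE (ordS_neq i)) eqxx. Qed.

Lemma gen_carries_out i x :
  x != i -> x != ordS i -> carries (gen i) [:: x] [:: x] 1.
Proof.
move=> xi xi'; move=> w /=.
by rewrite (negbTE xi) (negbTE xi') tpermD // eq_sym.
Qed.

(** The letter (i, true) stands for the i-th generator, (i, false) for its
    inverse. *)
Notation letter := ('I_d * bool)%type.

Section Words.
Implicit Types (l : letter) (w : seq letter).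

Definition leval l : Aut_tree d := if l.2 then gen l.1 else (gen l.1)^-1.
Definition weval w : Aut_tree d := foldr (fun l g => leval l * g) 1 w.

Definition lexpo l : int := (if l.2 then 1 else - 1)%R.
Definition wexpo w : int := (\sum_(l <- w) lexpo l)%R.

Definition lact l x : 'I_d := tperm l.1 (ordS l.1) x.

(** The inverse of a_i exchanges the letters before taking the section: its
    section at i is the inverse of the section a_(i+1) of a_i at i + 1. *)
Definition lsec l x : seq letter :=
  if x == l.1 then [:: (if l.2 then l.1 else ordS l.1, l.2)]
  else if x == ordS l.1 then [:: (if l.2 then ordS l.1 else l.1, l.2)]
  else [::].

Fixpoint wact w x : 'I_d := if w is l :: w' then wact w' (lact l x) else x.
Fixpoint wsec w x : seq letter :=
  if w is l :: w' then lsec l x ++ wsec w' (lact l x) else [::].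

Definition winv w : seq letter := rev [seq (l.1, ~~ l.2) | l <- w].

Lemma weval_cat w1 w2 : weval (w1 ++ w2) = weval w1 * weval w2.
Proof. by elim: w1 => [|l w1 IH] /=; rewrite ?mul1g // IH mulgA. Qed.

Lemma wexpo_cons l w : wexpo (l :: w) = (lexpo l + wexpo w)%R.
Proof. exact: big_cons. Qed.

Lemma wexpo_cat w1 w2 : wexpo (w1 ++ w2) = (wexpo w1 + wexpo w2)%R.
Proof. exact: big_cat. Qed.

Lemma wexpo_nil : wexpo [::] = 0%R.
Proof. exact: big_nil. Qed.

Lemma weval_inv w : weval (winv w) = (weval w)^-1.
Proof.
elim: w => [|l w IH] /=; first by rewrite invg1.
rewrite /winv /= rev_cons -cats1 weval_cat -/(winv w) IH invgM; congr (_ * _).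
by case: l => i [] /=; rewrite /leval /= mulg1 ?invgK.
Qed.

Lemma wexpo_inv w : wexpo (winv w) = (- wexpo w)%R.
Proof.
elim: w => [|l w IH] /=; first by rewrite wexpo_nil oppr0.
rewrite /winv /= rev_cons -cats1 wexpo_cat -/(winv w) IH !wexpo_cons wexpo_nil.
by case: l => i [] /=; rewrite /lexpo /=; lia.
Qed.

Lemma abs_wexpo_le w : (absz (wexpo w) <= size w)%N.
Proof.
elim: w => [|l w IH]; first by rewrite wexpo_nil.
by rewrite wexpo_cons /lexpo /=; case: ifP => _; lia.
Qed.

Lemma gen_in_G i : G (gen i).
Proof. by apply: sub_gen_smallest; exists i. Qed.

Lemma G1 : G 1. Proof. by case: (sgsetP (G_ d)). Qed.
Lemma GM g h : G g -> G h -> G (g * h).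
Proof. by case: (sgsetP (G_ d)) => _ + _; apply. Qed.
Lemma GV g : G g -> G g^-1.
Proof. by case: (sgsetP (G_ d)) => _ _; apply. Qed.

Lemma GX g n : G g -> G (g ^+ n).
Proof.
move=> Gg; elim: n => [|n IHn]; first exact: G1.
by rewrite expgS; apply: GM.
Qed.

Lemma GJ g h : G g -> G h -> G (g ^ h).
Proof. by move=> Gg Gh; rewrite conjgE; apply: GM; [apply: GV|apply: GM]. Qed.

Lemma leval_in_G l : G (leval l).
Proof. by rewrite /leval; case: ifP => _; [|apply: GV]; apply: gen_in_G. Qed.

Lemma weval_in_G w : G (weval w).
Proof.
elim: w => [|l w IH] /=; first exact: G1.
by apply: GM => //; apply: leval_in_G.
Qed.

Lemma G_ind (P : Aut_tree d -> Prop) :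
    P 1 -> (forall g h, G g -> G h -> P g -> P h -> P (g * h)) ->
    (forall g, G g -> P g -> P g^-1) -> (forall i, P (gen i)) ->
  forall g, G g -> P g.
Proof.
move=> P1 PM PV Pg g Gg.
suff: (G `&` P)%classic g by case.
apply: Gg; split; last by move=> _ [i _ <-]; split=> //; apply: gen_in_G.
split=> [|x y [Gx Px] [Gy Py]|x [Gx Px]]; first by split=> //; apply: G1.
  by split; [apply: GM|apply: PM].
by split; [apply: GV|apply: PV].
Qed.

Lemma GP g : G g -> exists w, weval w = g.
Proof.
elim/G_ind=> {g} [|_ _ _ _ [w <-] [w' <-]|_ _ [w <-]|i].
- by exists [::].
- by exists (w ++ w'); rewrite weval_cat.
- by exists (winv w); rewrite weval_inv.
- by exists [:: (i, true)]; rewrite /= mulg1.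
Qed.

Lemma leval_carries l x :
  carries (leval l) [:: x] [:: lact l x] (weval (lsec l x)).
Proof.
case: l => i b; rewrite /lsec /lact /leval /=.
have [->|xi] := eqVneq x i.
  rewrite tpermL; case: b => /=; rewrite mulg1 /leval /=.
    exact: gen_carries_l.
  exact/carriesV/gen_carries_r.
have [->|xi'] := eqVneq x (ordS i).
  rewrite tpermR; case: b => /=; rewrite mulg1 /leval /=.
    exact: gen_carries_r.
  exact/carriesV/gen_carries_l.
have -> : tperm i (ordS i) x = x by rewrite tpermD // eq_sym.
rewrite [weval _]/=; case: b; first exact: gen_carries_out.
by have := carriesV (gen_carries_out xi xi'); rewrite invg1.
Qed.

Lemma weval_carries w x :
  carries (weval w) [:: x] [:: wact w x] (weval (wsec w x)).
Proof.
elim: w x => [|l w IH] x /=; first exact: carries1.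
by rewrite weval_cat; apply: carriesM (IH _); apply: leval_carries.
Qed.

Lemma size_lsec l x : (size (lsec l x) <= 1)%N.
Proof. by rewrite /lsec; case: ifP => // _; case: ifP. Qed.

Lemma lsec_moved l x : lsec l x != [::] -> x = l.1 \/ x = ordS l.1.
Proof.
rewrite /lsec; case: (x =P l.1) => [-> _|_]; first by left.
by case: (x =P ordS l.1) => [-> _|//]; right.
Qed.

Lemma size_wsec w x : (size (wsec w x) <= size w)%N.
Proof.
elim: w x => //= l w IH x; rewrite size_cat.
by have := IH (lact l x); have := size_lsec l x; lia.
Qed.

(** Each generator has exactly two nontrivial sections, themselves
    generators. *)
Lemma sum_wexpo_wsec w :
  (\sum_x wexpo (wsec w x) = wexpo w + wexpo w)%R.
Proof.
elim: w => [|l w IH] /=.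
  by rewrite wexpo_nil big1 // => x _; rewrite wexpo_nil.
under eq_bigr => x _ do rewrite wexpo_cat.
rewrite big_split /= wexpo_cons.
have -> : (\sum_x wexpo (wsec w (lact l x)) = wexpo w + wexpo w)%R.
  by rewrite -IH [RHS](reindex_inj (@perm_inj _ (tperm l.1 (ordS l.1)))).
rewrite (bigD1 l.1) //= (bigD1 (ordS l.1)) ?ordS_neq //= big1 => [|x].
  rewrite /lsec eqxx (negbTE (ordS_neq _)) eqxx !wexpo_cons wexpo_nil /lexpo /=.
  by ring.
by move=> /andP[xi xi']; rewrite /lsec (negbTE xi) (negbTE xi') wexpo_nil.
Qed.

(** If two letters are moved at each step of a word, they keep exchanging their
    places; as d > 2, only one generator exchanges two given letters. *)
Lemma two_long_sections w x y :
    x != y -> size (wsec w x) = size w -> size (wsec w y) = size w ->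
  forall l l', l \in w -> l' \in w -> l.1 = l'.1.
Proof.
have all_same i : forall w x y,
    [|| (x == i) && (y == ordS i) | (x == ordS i) && (y == i)] ->
    size (wsec w x) = size w -> size (wsec w y) = size w ->
    forall l, l \in w -> l.1 = i.
  elim=> // l w' IH x' y' xy /=; rewrite !size_cat => sx sy.
  have sx' := size_wsec w' (lact l x'); have sy' := size_wsec w' (lact l y').
  have lx := size_lsec l x'; have ly := size_lsec l y'.
  have li : l.1 = i.
    have {}sx : lsec l x' != [::] by case: (lsec l x') sx => //=; lia.
    have {}sy : lsec l y' != [::] by case: (lsec l y') sy => //=; lia.
    have /eqP n1 := ordS_neq l.1; have /eqP n2 := ordSS_neq l.1.
    have /eqP n3 := ordS_neq i.
    by case: (lsec_moved sx) (lsec_moved sy) xy => ex [] ey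
      /orP[/andP[/eqP e1 /eqP e2]|/andP[/eqP e1 /eqP e2]]; congruence.
  move=> l'; rewrite inE => /predU1P[->//|].
  apply: (IH (lact l x') (lact l y')).
  - case/orP: xy => /andP[/eqP-> /eqP->];
      by rewrite /lact li tpermL tpermR !eqxx ?orbT.
  - by lia.
  - by lia.
case: w => // l0 w xy sx sy l l' lw l'w.
suff e : forall l, l \in l0 :: w -> l.1 = l0.1 by rewrite (e l) // (e l').
apply: (all_same _ _ x y) => //.
move: sx sy => /=; rewrite !size_cat => sx sy.
have sx' := size_wsec w (lact l0 x); have sy' := size_wsec w (lact l0 y).
have {}sx : lsec l0 x != [::] by case: (lsec l0 x) sx => //=; lia.
have {}sy : lsec l0 y != [::] by case: (lsec l0 y) sy => //=; lia.
by case: (lsec_moved sx) (lsec_moved sy) xy => -> [] ->; rewrite ?eqxx ?orbT.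
Qed.

Lemma wsec_single i w x :
  (forall l, l \in w -> l.1 = i) -> x != i -> x != ordS i -> wsec w x = [::].
Proof.
elim: w x => //= l w IH x wi xi xi'.
have li : l.1 = i by apply: wi; rewrite mem_head.
rewrite /lsec /lact li (negbTE xi) (negbTE xi') tpermD ?IH // 1?eq_sym //.
by move=> l' l'w; apply: wi; rewrite inE l'w orbT.
Qed.

(** Induction on the length of the relator and then, downwards, on the absolute
    value of its exponent; the measure mu encodes this lexicographic order. *)
Lemma wexpo_relator w : weval w = 1 -> wexpo w = 0%R.
Proof.
pose mu w := (size w * size w + (size w - absz (wexpo w)))%N.
have [n] := ubnP (mu w); elim: n w => // n IHn w mun w1.
have {IHn} IH w' : mu w' < mu w -> weval w' = 1 -> wexpo w' = 0%R.
  by move=> muw'; apply: IHn; lia.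
clear n mun.
have sec1 w' x : weval w' = 1 -> weval (wsec w' x) = 1.
  move=> w'1; have := @weval_carries w' x; rewrite w'1.
  by move/carries_fun => /(_ _ _ (@carries1 _ _)) [].
(* no relator precedes w, so w is a shortest one of nonzero exponent *)
have small w' : weval w' = 1 -> wexpo w' <> 0%R -> size w' <= size w ->
    size w' = size w /\ (absz (wexpo w') <= absz (wexpo w))%N.
  move=> w'1 w'0 sw'.
  have : ~ mu w' < mu w by move=> /IH /(_ w'1).
  rewrite /mu; have := abs_wexpo_le w'; have := abs_wexpo_le w.
  move: (absz _) (absz _) (size w) (size w') sw' => a b s s' ss' la lb.
  by nia.
(* as the exponents of the sections are bounded by that of w' and add up to
   twice that, at least two of them are as long as w' *)
have single w' : weval w' = 1 -> wexpo w' <> 0%R -> size w' = size w ->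
    absz (wexpo w') = absz (wexpo w) ->
    exists i, (forall l, l \in w' -> l.1 = i) /\
      wexpo (wsec w' i) = wexpo w'.
  move=> w'1 w'0 sw' ew'.
  have long x : wexpo (wsec w' x) <> 0%R -> size (wsec w' x) = size w' /\
      (absz (wexpo (wsec w' x)) <= absz (wexpo w'))%N.
    move=> x0; have := small (wsec w' x) (sec1 _ _ w'1) x0.
    by rewrite -sw' -ew'; apply; apply: size_wsec.
  have sum := sum_wexpo_wsec w'.
  have [x x0] : exists x, wexpo (wsec w' x) <> 0%R.
    apply: contrapT => /forallNP no; move: sum; rewrite big1; first by lia.
    by move=> x _; apply: contrapT (no x).
  have [y [yx y0]] : exists y, y != x /\ wexpo (wsec w' y) <> 0%R.
    apply: contrapT => /forallNP no; move: sum; rewrite (bigD1 x) //= big1.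
      by have [_] := long x x0; lia.
    by move=> y yx; apply: contrapT => y0; apply: (no y).
  have [sx _] := long x x0; have [sy _] := long y y0.
  have same := two_long_sections yx sy sx.
  have [l lw'] : exists l, l \in w'.
    case: (w') w'0 => [|l v _]; first by rewrite wexpo_nil.
    by exists l; rewrite mem_head.
  exists l.1; split=> [l' l'w'|]; first exact: same.
  move: sum; rewrite (bigD1 l.1) //= (bigD1 (ordS l.1)) ?ordS_neq //= big1.
    have e z : (absz (wexpo (wsec w' z)) <= absz (wexpo w'))%N.
      by have [->//|/eqP/long[]//] := eqVneq (wexpo (wsec w' z)) 0%R.
    by have := e l.1; have := e (ordS l.1); lia.
  move=> z /andP[zl zl']; rewrite (wsec_single (i := l.1)) ?wexpo_nil //.
  by move=> l' l'w'; apply: same.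
apply: contrapT => w0.
have [i [wi ewi]] := single w w1 w0 erefl erefl.
(* the section of w at i is again extremal, hence a word in one generator *)
have ei : wexpo (wsec w i) <> 0%R by rewrite ewi.
have [si _] := small _ (sec1 _ i w1) ei (size_wsec w i).
have [j [wj _]] := single _ (sec1 _ i w1) ei si (congr1 absz ewi).
have ii' := ordS_neq i.
case: w {ewi ei si single small sec1} w0 w1 wi wj IH
  => [|[i0 b0] [|[i1 b1] w]] w0 w1 wi wj IH.
- by rewrite wexpo_nil in w0.
(* a single generator is not a relator *)
- have := @weval_carries [:: (i0, b0)] i0; rewrite w1.
  move/carries_fun => /(_ _ _ (@carries1 _ _)) [/=].
  by rewrite /lact tpermL => -[/eqP]; rewrite (negbTE (ordS_neq i0)).
have e0 : i0 = i by apply: (wi (i0, b0)); rewrite mem_head.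
have e1 : i1 = i by apply: (wi (i1, b1)); rewrite !inE eqxx orbT.
subst i0 i1.
(* equal signs give the section at i two letters of different index, opposite
   signs allow a cancellation in w *)
have [b01|b01] := eqVneq b0 b1.
  move: wj; rewrite /= /lsec /lact eqxx tpermL (negbTE ii') eqxx -b01 /= => wj.
  have := wj _ (mem_head _ _).
  rewrite -(wj (if b0 then ordS i else i, b0)); last by rewrite !inE eqxx orbT.
  by case: (b0) => /= /eqP; rewrite ?(negbTE ii') // eq_sym (negbTE ii').
have ew : wexpo [:: (i, b0), (i, b1) & w] = wexpo w.
  rewrite !wexpo_cons /lexpo /=.
  by case: (b0) (b1) b01 => [] []; lia.
apply: w0; rewrite ew; apply: IH.
  have := abs_wexpo_le w; rewrite /mu ew /=; nia.
move: w1; rewrite /= /leval /=.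
by case: (b0) (b1) b01 => [] [] // _; rewrite ?mulKg ?mulVKg.
Qed.

End Words.

(** * The degree homomorphism *)

Definition word_of g : seq letter :=
  xget [::] [set w : seq letter | weval w = g]%classic.
Definition deg g : int := wexpo (word_of g).

Lemma word_ofK g : G g -> weval (word_of g) = g.
Proof. by move=> /GP[w wg]; rewrite /word_of; case: xgetP => // /(_ w). Qed.

Lemma deg_weval w : deg (weval w) = wexpo w.
Proof.
have := word_ofK (weval_in_G w); rewrite /deg; set w' := word_of _ => w'w.
have : weval (w' ++ winv w) = 1 by rewrite weval_cat weval_inv w'w mulgV.
by move/wexpo_relator; rewrite wexpo_cat wexpo_inv; lia.
Qed.

Lemma degM g h : G g -> G h -> deg (g * h) = (deg g + deg h)%R.
Proof.
move=> /GP[w <-] /GP[w' <-].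
by rewrite -weval_cat !deg_weval wexpo_cat.
Qed.

Lemma deg1 : deg 1 = 0%R.
Proof. by rewrite -[1]/(weval [::]) deg_weval wexpo_nil. Qed.

Lemma degV g : G g -> deg g^-1 = (- deg g)%R.
Proof. by move=> /GP[w <-]; rewrite -weval_inv !deg_weval wexpo_inv. Qed.

Lemma degX g n : G g -> deg (g ^+ n) = (n%:Z * deg g)%R.
Proof.
move=> Gg; elim: n => [|n IHn]; first by rewrite deg1 mul0r.
by rewrite expgS degM ?IHn //; [lia|apply: GX].
Qed.

Lemma deg_gen i : deg (gen i) = 1%R.
Proof.
have -> : gen i = weval [:: (i, true)] by rewrite /= mulg1.
by rewrite deg_weval wexpo_cons wexpo_nil addr0.
Qed.

Lemma G_section g x :
  G g -> exists y h, G h /\ carries g [:: x] [:: y] h.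
Proof.
move=> /GP[w <-]; exists (wact w x), (weval (wsec w x)).
by split; [apply: weval_in_G|apply: weval_carries].
Qed.

Lemma sum_deg_sections g (y : 'I_d -> 'I_d) (h : 'I_d -> Aut_tree d) :
  G g -> (forall x, carries g [:: x] [:: y x] (h x)) ->
  (\sum_x deg (h x) = 2 * deg g)%R.
Proof.
move=> /GP[w <-] wh; rewrite deg_weval mulrDl !mul1r -sum_wexpo_wsec.
apply: eq_bigr => x _.
by have [_ ->] := carries_fun (wh x) (@weval_carries w x); rewrite deg_weval.
Qed.

(** An element fixing the first level is a product of an even number of
    transpositions of letters. *)
Lemma deg_even g :
  G g -> (forall x, g [:: x] = [:: x]) -> (2 %| deg g)%Z.
Proof.
move=> /GP[w <-] w1; rewrite deg_weval.
pose s (v : seq letter) : {perm 'I_d} :=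
  foldr (fun (l : letter) p => tperm l.1 (ordS l.1) * p) 1 v.
have sE v x : s v x = wact v x.
  by elim: v x => [|l v IH] x /=; rewrite ?perm1 // permM IH.
have sw : s w = 1.
  apply/permP => x; rewrite sE perm1.
  by have /carriesE := @weval_carries w x; rewrite w1 => -[].
have odd_s v : odd_perm (s v) = odd (size v).
  elim: v => [|l v IH] /=; first exact: odd_perm1.
  by rewrite odd_permM IH odd_tperm eq_sym ordS_neq.
have odd_e v : exists k : int, (wexpo v = (size v)%:Z + 2 * k)%R.
  elim: v => [|l v [k IH]]; first by exists 0%R; rewrite wexpo_nil.
  rewrite wexpo_cons IH /lexpo; case: ifP => _ /=; first by exists k; lia.
  by exists (k - 1)%R; lia.
have := odd_s w; rewrite sw odd_perm1; have [k ->] := odd_e w.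
by lia.
Qed.


(** * Branching *)

Hypothesis d_odd : odd d.

Lemma iter_ordS_period i : iter d (@ordS d) i = i.
Proof. by apply: val_inj; rewrite val_iter_ordS modnDr modn_small. Qed.

Lemma iter_ordS_onto i x : exists2 m, m < d & x = iter m (@ordS d) i.
Proof.
exists ((x + (d - i)) %% d); first by rewrite ltn_pmod; lia.
apply: val_inj; rewrite val_iter_ordS modnDmr addnCA.
rewrite subnKC ?(ltnW (ltn_ord i)) //.
by rewrite modnDr modn_small.
Qed.

(** As d is odd, the steps of length two connect all letters. *)
Lemma iter_ordS2_onto i x : exists m, x = iter m (fun j => ordS (ordS j)) i.
Proof.
have iter2 m j : iter m (fun j => ordS (ordS j)) j = iter (2 * m) (@ordS d) j.
  by elim: m => // m IH; rewrite iterS IH mulnS.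
have [m md ->] := iter_ordS_onto i x.
have [m_odd|m_even] := boolP (odd m); last first.
  by exists m./2; rewrite iter2; congr (iter _ _ _); lia.
exists ((m + d)./2); rewrite iter2.
have -> : (2 * (m + d)./2 = m + d)%N by lia.
by rewrite iterD iter_ordS_period.
Qed.

(** The section a_(i+1)^-1 of a_i^-1 at i cancels against the section of a_(i+1)
    at i + 1, so two steps around the cycle of letters can be made with a
    trivial section. *)
Definition double_step i : Aut_tree d := (gen i)^-1 * gen (ordS i).

Lemma double_step_in_G i : G (double_step i).
Proof. by apply: GM; [apply: GV|]; apply: gen_in_G. Qed.

Lemma double_step_carries i :
  carries (double_step i) [:: i] [:: ordS (ordS i)] 1.
Proof.
rewrite -(mulVg (gen (ordS i))).
exact: carriesM (carriesV (@gen_carries_r i)) (@gen_carries_l _).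
Qed.

Lemma gen_inv_carries_out i x :
  x != i -> x != ordS i -> carries (gen i)^-1 [:: x] [:: x] 1.
Proof.
by move=> xi xi'; rewrite -invg1; apply: carriesV; apply: gen_carries_out.
Qed.

Lemma double_step_out i x :
    x != i -> x != ordS i -> x != ordS (ordS i) ->
  carries (double_step i) [:: x] [:: x] 1.
Proof.
move=> x0 x1 x2; rewrite -[1]mulg1.
exact: carriesM (gen_inv_carries_out x0 x1) (gen_carries_out x1 x2).
Qed.

(** Moving between all letters with trivial section, and with section a_i from
    i to i + 1, realizes every group element as a section between any two
    letters. *)
Lemma letter_transport x y h :
  G h -> exists2 f, G f & carries f [:: x] [:: y] h.
Proof.
pose R x h y := exists2 f, G f & carries f [:: x] [:: y] h.
rewrite -/(R x h y).
have RM x' y' z' h1 h2 : R x' h1 y' -> R y' h2 z' -> R x' (h1 * h2) z'.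
  move=> [f Gf fx] [f' Gf' fy]; exists (f * f'); first exact: GM.
  exact: carriesM fx fy.
have RV x' y' h1 : R x' h1 y' -> R y' h1^-1 x'.
  by move=> [f Gf fx]; exists f^-1; [apply: GV|apply: carriesV].
have R1 x' y' : R x' 1 y'.
  have [m ->] := iter_ordS2_onto x' y'.
  elim: m => [|m IHm]; first by exists 1; [apply: G1|apply: carries1].
  rewrite iterS -[1]mulg1; apply: RM IHm _.
  by exists (double_step (iter m (fun j => ordS (ordS j)) x'));
    [apply: double_step_in_G|apply: double_step_carries].
move=> Gh; elim/G_ind: h / Gh x y => [x y|h h' _ _ IH IH' x y|h _ IH x y|i x y].
- exact: R1.
- exact: RM (IH x x) (IH' x y).
- exact/RV/IH.
- rewrite -[gen i]mul1g; apply: (RM _ _ _ _ _ (R1 x i)).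
  rewrite -[gen i]mulg1; apply: RM (R1 (ordS i) y).
  by exists (gen i); [apply: gen_in_G|apply: gen_carries_l].
Qed.

(** A generator that moves the second letter along the cycle with the first
    letter removed has a trivial section at the first letter, so the second
    letter can be put anywhere without changing the section at the first. *)
Lemma pair_transport x y x' y' h :
    x != y -> x' != y' -> G h ->
  exists2 f, G f & carries f [:: x] [:: x'] h /\
    exists2 k, G k & carries f [:: y] [:: y'] k.
Proof.
pose R y y' := exists2 f, G f & carries f [:: x'] [:: x'] 1 /\
  exists2 k, G k & carries f [:: y] [:: y'] k.
have RM y1 y2 y3 : R y1 y2 -> R y2 y3 -> R y1 y3.
  move=> [f Gf [fx [k Gk fy]]] [f' Gf' [fx' [k' Gk' fy']]].
  exists (f * f'); first exact: GM.
  split; first by rewrite -[1]mulg1; apply: carriesM fx fx'.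
  by exists (k * k'); [apply: GM|apply: carriesM fy fy'].
have RV y1 y2 : R y1 y2 -> R y2 y1.
  move=> [f Gf [fx [k Gk fy]]]; exists f^-1; first exact: GV.
  split; first by rewrite -invg1; apply: carriesV.
  by exists k^-1; [apply: GV|apply: carriesV].
have R1 m : 0 < m < d -> R (iter m (@ordS d) x') (ordS x').
  elim: m => // m IHm md; case: m IHm md => [_ _|m IHm md].
    exists 1; first exact: G1.
    by split; [|exists 1; [apply: G1|]]; apply: carries1.
  apply: RM (IHm _); last by lia.
  exists (gen (iter m.+1 (@ordS d) x')); first exact: gen_in_G.
  split; last by exists (gen (ordS (iter m.+1 (@ordS d) x')));
    [apply: gen_in_G|apply: gen_carries_r].
  by apply: gen_carries_out; rewrite eq_sym;
    [apply: (@iter_ordS_neq x' 0 m.+1)|apply: (@iter_ordS_neq x' 0 m.+2)]; lia.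
have R2 y1 : x' != y1 -> R y1 (ordS x').
  have [m md ->] := iter_ordS_onto x' y1 => xm; apply: R1.
  by case: m md xm => [|m] md; rewrite ?eqxx.
move=> xy xy' Gh; have [f Gf fx] := letter_transport x x' Gh.
have [y1 [k [Gk fy]]] := G_section y Gf.
have xy1 : x' != y1.
  apply: contra xy => /eqP e; rewrite -e in fy.
  by have [->] := carries_inj fx fy.
have [f' Gf' [fx' [k' Gk' fy']]] := RM _ _ _ (R2 _ xy1) (RV _ _ (R2 _ xy')).
exists (f * f'); first exact: GM.
split; first by rewrite -[h]mulg1; apply: carriesM fx fx'.
by exists (k * k'); [apply: GM|apply: carriesM fy fy'].
Qed.

Lemma diag_at2J f x x' h y y' k p q :
    G f -> x != y -> carries f [:: x] [:: x'] h -> carries f [:: y] [:: y'] k ->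
  diag (at2 x p y q) ^ f = diag (at2 x' (p ^ h) y' (q ^ k)).
Proof.
move=> Gf xy fx fy; apply: diagP => z'; rewrite conjgE.
have [z [l [Gl fz']]] := G_section z' (GV Gf).
have fz := carriesV fz'; rewrite invgK in fz.
have := carriesM fz' (carriesM (diag_carries (at2 x p y q) z) fz).
congr carries; rewrite /at2.
have [zx|zx] := eqVneq z x.
  rewrite zx in fz; have [[->] <-] := carries_fun fz fx.
  by rewrite eqxx conjgE invgK.
have [zy|zy] := eqVneq z y.
  rewrite zy in fz; have [[->] <-] := carries_fun fz fy.
  case: eqP => [e|_]; last by rewrite eqxx conjgE invgK.
  rewrite e in fy; have [e'] := carries_inj fx fy.
  by rewrite e' eqxx in xy.
rewrite mul1g mulgV.
case: eqP => [e|_].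
  by rewrite e in fz; have [e'] := carries_inj fx fz; rewrite e' eqxx in zx.
case: eqP => [e|//].
by rewrite e in fz; have [e'] := carries_inj fy fz; rewrite e' eqxx in zy.
Qed.

Lemma diag_at1J f x x' h p :
    G f -> carries f [:: x] [:: x'] h ->
  diag (at1 x p) ^ f = diag (at1 x' (p ^ h)).
Proof.
move=> Gf fx; have [y' [k [_ fy]]] := G_section (ordS x) Gf.
rewrite -(at21 x p (ordS x)) (diag_at2J p 1 Gf _ fx fy) ?conj1g ?at21 //.
by rewrite eq_sym ordS_neq.
Qed.

(** Moving i - 1 to i + 2 by double steps, then to i + 1, conjugates a_(i-1)
    into an element that, like a_i, exchanges i and i + 1. *)
Lemma exchange_relation i (j := ordS i) (k := ordS j) (l := ord_pred i) :
  G (diag (at2 i (gen i * gen k * (gen i)^-1)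
               j ((gen k)^-1 * gen l * (gen j)^-1))).
Proof.
have lj : ordS l = i by rewrite ord_predK.
have far m : (2 * m + 2 < d)%N -> exists2 f, G f &
    carries f [:: i] [:: i] 1 /\
    carries f [:: k] [:: iter (2 * m + 2) (@ordS d) i] 1.
  elim: m => [_|m IHm md].
    by exists 1; [apply: G1|split; apply: carries1].
  have [|f Gf [fi fk]] := IHm; first by lia.
  exists (f * double_step (iter (2 * m + 2) (@ordS d) i)).
    by apply: GM => //; apply: double_step_in_G.
  rewrite -[1]mulg1; split; [apply: carriesM fi _|apply: carriesM fk _].
    by apply: double_step_out; rewrite eq_sym;
      [apply: (@iter_ordS_neq i 0 (2 * m + 2))
      |apply: (@iter_ordS_neq i 0 (2 * m + 2).+1)
      |apply: (@iter_ordS_neq i 0 (2 * m + 2).+2)]; lia.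
  have -> : (2 * m.+1 + 2 = (2 * m + 2).+2)%N by lia.
  exact: double_step_carries.
have [|f Gf [fi fk]] := far (d - 3)./2; first by lia.
have el : iter (2 * (d - 3)./2 + 2) (@ordS d) i = l.
  apply: ordS_inj; rewrite lj -iterS.
  have -> : (2 * (d - 3)./2 + 2).+1 = d by lia.
  exact: iter_ordS_period.
rewrite {}el in fk.
have nij : i != j by rewrite eq_sym ordS_neq.
have nik : i != k by rewrite eq_sym ordSS_neq.
have njk : j != k by rewrite eq_sym ordS_neq.
have nil : i != l by rewrite -{1}lj ordS_neq.
have njl : j != l by rewrite /j -{1}lj ordSS_neq.
pose F := f^-1 * gen j.
have GF : G F by apply: GM; [apply: GV|apply: gen_in_G].
have Fi : carries F [:: i] [:: i] 1.
  rewrite -[1]mulg1; apply: carriesM (gen_carries_out nij nik).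
  by rewrite -invg1; apply: carriesV.
have Fl : carries F [:: l] [:: j] (gen k).
  rewrite -[gen k]mul1g; apply: carriesM (@gen_carries_r j).
  by rewrite -invg1; apply: carriesV.
have gi : carries (gen l) [:: i] [:: l] (gen i).
  by have := @gen_carries_r l; rewrite lj.
have gl : carries (gen l) [:: l] [:: i] (gen l).
  by have := @gen_carries_l l; rewrite lj.
suff <- : gen l ^ F * (gen i)^-1 =
    diag (at2 i (gen i * gen k * (gen i)^-1)
              j ((gen k)^-1 * gen l * (gen j)^-1)).
  by apply: GM; [apply: GJ|apply: GV]; rewrite ?GF //; apply: gen_in_G.
apply: diagP => z; rewrite /at2 conjgE.
have [->|zi] := eqVneq z i.
  have <- : 1^-1 * (gen i * gen k) * (gen i)^-1 = gen i * gen k * (gen i)^-1.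
    by rewrite invg1 mul1g.
  apply: carriesM (carriesV (@gen_carries_l i)).
  apply: carriesM (carriesV Fi) _; exact: carriesM gi Fl.
have [->|zj] := eqVneq z j.
  apply: carriesM (carriesV (@gen_carries_r i)).
  apply: carriesM (carriesV Fl) _.
  by rewrite -[X in carries _ _ _ X]mulg1; apply: carriesM gl Fi.
have [z' [k' [_ Fz]]] := G_section z (GV GF).
have Fz' := carriesV Fz; rewrite invgK in Fz'.
rewrite -[1]mulg1; apply: carriesM (gen_inv_carries_out zi zj).
rewrite -(mulgV k'); apply: carriesM Fz _; rewrite -[k'^-1]mul1g.
apply: (carriesM _ Fz'); apply: gen_carries_out.
  apply: contra zj => /eqP e; rewrite e in Fz'.
  by have [[->]] := carries_fun Fz' Fl.
rewrite lj; apply: contra zi => /eqP e; rewrite e in Fz'.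
by have [[->]] := carries_fun Fz' Fi.
Qed.

(** By transport, the elements p that extend form a normal subgroup that does
    not depend on x and y; the exchange relation puts a conjugate of each
    generator into it. *)
Lemma pair_extension x y p :
  x != y -> G p -> exists2 q, G q & G (diag (at2 x p y q)).
Proof.
pose Q p := forall x y, x != y -> exists2 q, G q & G (diag (at2 x p y q)).
move=> xy Gp; suff: Q p by apply.
have QJ x1 y1 p1 q1 k : x1 != y1 -> G p1 -> G q1 -> G k ->
    G (diag (at2 x1 p1 y1 q1)) -> Q (p1 ^ k).
  move=> xy1 Gp1 Gq1 Gk G12 x2 y2 xy2.
  have [f Gf [fx [l Gl fy]]] := pair_transport xy1 xy2 Gk.
  exists (q1 ^ l); first exact: GJ.
  by rewrite -(diag_at2J p1 q1 Gf xy1 fx fy); apply: GJ.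
elim/G_ind: p / Gp => [x1 y1 _|p1 p2 _ _ Q1 Q2 x1 y1 xy1|p1 _ Q1 x1 y1 xy1|i].
- exists 1; first exact: G1.
  suff <- : 1 = diag (at2 x1 1 y1 1) by apply: G1.
  by apply: diagP => z; rewrite /at2 !if_same.
- have [q1 Gq1 G11] := Q1 _ _ xy1; have [q2 Gq2 G22] := Q2 _ _ xy1.
  by exists (q1 * q2); [apply: GM|rewrite -diag_at2M; apply: GM].
- have [q1 Gq1 G11] := Q1 _ _ xy1.
  by exists q1^-1; [apply: GV|rewrite -diag_at2V; apply: GV].
- pose j := ord_pred (ord_pred i).
  have := exchange_relation j; rewrite /j !ord_predK.
  set p1 := gen _ * gen i * _ => H.
  have -> : gen i = p1 ^ gen (ord_pred (ord_pred i)).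
    by rewrite /p1 conjgE !mulgA mulgVK mulVg mul1g.
  apply: (QJ _ _ _ _ _ _ _ _ _ H).
  + rewrite -(inj_eq (@ordS_inj _)) !ord_predK eq_sym.
    by rewrite -{1}(ord_predK i) ordS_neq.
  + by rewrite /p1; do ![apply: GM | apply: GV]; apply: gen_in_G.
  + by do ![apply: GM | apply: GV]; apply: gen_in_G.
  + exact: gen_in_G.
Qed.

(** A normal subgroup over which the group branches: it contains all
    commutators, and the first level stabilizer contains the product of d copies
    of it. *)
Definition branching p : Prop := G p /\ forall x, G (diag (at1 x p)).

Lemma branchingM p q : branching p -> branching q -> branching (p * q).
Proof.
move=> [Gp Dp] [Gq Dq]; split; first exact: GM.
by move=> x; rewrite -diag_at1M; apply: GM.
Qed.

Lemma branchingV p : branching p -> branching p^-1.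
Proof.
move=> [Gp Dp]; split; first exact: GV.
by move=> x; rewrite -diag_at1V; apply: GV.
Qed.

Lemma branching_at x p : G p -> G (diag (at1 x p)) -> branching p.
Proof.
move=> Gp Gx; split=> // y; have [f Gf fx] := letter_transport x y G1.
by rewrite -[p]conjg1 -(diag_at1J p Gf fx); apply: GJ.
Qed.

Lemma branchingJ p g : branching p -> G g -> branching (p ^ g).
Proof.
move=> [Gp Dp] Gg; split; first exact: GJ.
move=> x; have [f Gf fx] := letter_transport x x Gg.
by rewrite -(diag_at1J p Gf fx); apply: GJ.
Qed.

(** Two elements of the first level stabilizer whose supports meet in a single
    letter have a commutator supported at that letter. *)
Lemma branching_commg p q : G p -> G q -> branching [~ p, q].
Proof.
move=> Gp Gq; split.
  by rewrite commgEl; apply: GM; [apply: GV|apply: GJ].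
move=> x; set y := ordS x; set z := ordS y.
have xy : x != y by rewrite eq_sym ordS_neq.
have xz : x != z by rewrite eq_sym ordSS_neq.
have yz : y != z by rewrite eq_sym ordS_neq.
have [p' Gp' Gxy] := pair_extension xy Gp.
have [q' Gq' Gxz] := pair_extension xz Gq.
suff -> : diag (at1 x [~ p, q]) = [~ diag (at2 x p y p'), diag (at2 x q z q')].
  by rewrite commgEl; apply: GM; [apply: GV|apply: GJ].
rewrite !commgEl !conjgE !diagV !diagM; congr diag; apply/funext => t.
rewrite /at1 /at2; case: eqP => // _; case: eqP => [->|_].
  by rewrite (negbTE yz) invg1 mul1g mulg1 mulVg.
by rewrite mul1g invg1 mul1g mulVg.
Qed.

Definition branch_cong p q : Prop := branching (p * q^-1).

Lemma branch_cong_sym p q : branch_cong p q -> branch_cong q p.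
Proof. by move/branchingV; rewrite invgM invgK. Qed.

Lemma branch_cong_trans q p r :
  branch_cong p q -> branch_cong q r -> branch_cong p r.
Proof. by move=> pq qr; have := branchingM pq qr; rewrite mulgA mulgVK. Qed.

Lemma branch_congM p p' q q' : G q -> G p ->
  branch_cong p p' -> branch_cong q q' -> branch_cong (p * q) (p' * q').
Proof.
move=> Gq Gp pp' qq'; apply: (branch_cong_trans (q := p * q')).
  rewrite /branch_cong.
  have -> : p * q * (p * q')^-1 = (q * q'^-1) ^ p^-1.
    by rewrite invgM conjgE invgK !mulgA.
  by apply: branchingJ => //; apply: GV.
by rewrite /branch_cong invgM mulgA mulgK.
Qed.

(** Let q be a companion of p, with p at x and q at z. Transport to the letters
    z and y gives an element with q at z and a conjugate of p at y; in the
    quotient of the two, q cancels and p remains at x, with the inverse of a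
    conjugate of p at y. The conjugation is corrected by a commutator. *)
Lemma pair_inverse x y p : x != y -> G p -> G (diag (at2 x p y p^-1)).
Proof.
move=> xy Gp.
have [z /andP[zx zy]] : exists z, (z != x) && (z != y).
  have [<-|yx] := eqVneq (ordS x) y.
    by exists (ordS (ordS x)); rewrite ordSS_neq ordS_neq.
  by exists (ordS x); rewrite ordS_neq.
have zx' : x != z by rewrite eq_sym.
have yz : y != z by rewrite eq_sym.
have yx : y != x by rewrite eq_sym.
have [q Gq Gxz] := pair_extension zx' Gp.
have [f Gf [fz [k Gk fx]]] := pair_transport zx zy G1.
have Gzy : G (diag (at2 z q y (p ^ k))).
  by rewrite -[q]conjg1 -(diag_at2J q p Gf zx fz fx) -at2_sym //; apply: GJ.
have Dp : branching ((p ^ k) * p^-1).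
  have -> : (p ^ k) * p^-1 = [~ p, k] ^ p^-1.
    by rewrite commgEl [RHS]conjgE invgK -[p^-1 * _ * _]mulgA mulVKg.
  by apply: branchingJ; [apply: branching_commg|apply: GV].
have [_ /(_ y) Gy] := Dp.
have -> : diag (at2 x p y p^-1) = diag (at2 x p z q) *
    (diag (at2 z q y (p ^ k)))^-1 * diag (at1 y ((p ^ k) * p^-1)).
  rewrite diagV !diagM; congr diag; apply/funext => t; rewrite /at1 /at2.
  have [->|_] := eqVneq t x.
    by rewrite (negbTE zx') (negbTE xy) invg1 !mulg1.
  have [->|_] := eqVneq t y.
    by rewrite (negbTE yz) mul1g mulKg.
  by have [_|_] := eqVneq t z; rewrite ?invg1 ?mulg1 ?mulgV.
by apply: GM => //; apply: GM => //; apply: GV.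
Qed.

Lemma branching_of_pair x y p q :
  x != y -> G p -> G q -> G (diag (at2 x p y q)) -> branching (p * q).
Proof.
move=> xy Gp Gq Gpq; apply: (branching_at (x := y)); first exact: GM.
rewrite -(at12 _ xy) -(mulVg p) -diag_at2M; apply: GM => //.
by rewrite -[X in at2 _ _ _ X]invgK; apply: pair_inverse => //; apply: GV.
Qed.

Lemma branch_cong_gen_pred i : branch_cong (gen (ord_pred i)) (gen (ordS i)).
Proof.
have Ggen := gen_in_G.
have H := exchange_relation i; set k := ordS (ordS i) in H.
rewrite /branch_cong.
have -> : gen (ord_pred i) * (gen (ordS i))^-1 =
  [~ (gen i)^-1, (gen k)^-1]^-1 * (gen i * gen k * (gen i)^-1 *
     ((gen k)^-1 * gen (ord_pred i) * (gen (ordS i))^-1)).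
  apply: (canRL (mulKg _)).
  by rewrite commgEl conjgE !invgK !mulgA.
apply: branchingM; last apply: branching_of_pair H.
- by apply: branchingV; apply: branching_commg; apply: GV.
- by rewrite eq_sym ordS_neq.
- by do ![apply: GM | apply: GV].
- by do ![apply: GM | apply: GV].
Qed.

Lemma branch_cong_refl p : branch_cong p p.
Proof.
rewrite /branch_cong mulgV; split; first exact: G1.
move=> x; suff <- : 1 = diag (at1 x 1) by apply: G1.
by apply: diagP => z; rewrite /at1 if_same.
Qed.

Lemma branch_cong_gen i j : branch_cong (gen i) (gen j).
Proof.
have [m ->] := iter_ordS2_onto i j; elim: m => [|m IHm].
  exact: branch_cong_refl.
apply: (branch_cong_trans IHm); rewrite iterS; set t := iter _ _ _.
by have := branch_cong_gen_pred (ordS t); rewrite ordSK.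
Qed.

(** With h = a_i a_(i+1), the square of a_i has sections h at i and
    a_(i+1) a_i at i + 1, while h can also be completed by its inverse; so
    h a_(i+1) a_i is branching. *)
Lemma branching_gen4 i : branching (gen i ^+ 4).
Proof.
set j := ordS i; have ij : i != j by rewrite eq_sym ordS_neq.
have Gi := gen_in_G i; have Gj := gen_in_G j.
have Gpair : G (diag (at2 i (gen i * gen j) j (gen j * gen i))).
  suff <- : gen i * gen i = diag (at2 i (gen i * gen j) j (gen j * gen i)).
    exact: GM.
  apply: diagP => z; rewrite /at2; have [->|zi] := eqVneq z i.
    exact: carriesM (@gen_carries_l i) (@gen_carries_r i).
  have [->|zj] := eqVneq z j.
    exact: carriesM (@gen_carries_r i) (@gen_carries_l i).
  by rewrite -[1]mulg1; apply: carriesM; apply: gen_carries_out.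
have := branching_of_pair ij (GM Gi Gj) (GM Gj Gi) Gpair.
have e := branch_cong_gen i j.
have : branch_cong (gen i ^+ 4) (gen i * gen j * (gen j * gen i)).
  have -> : gen i ^+ 4 = gen i * gen i * (gen i * gen i).
    by rewrite !expgS expg0 mulg1 !mulgA.
  have r := branch_cong_refl (gen i).
  apply: branch_congM; [exact: GM|exact: GM| |].
    exact: branch_congM.
  exact: branch_congM.
by move=> D1 D2; have := branchingM D1 D2; rewrite mulgVK.
Qed.

(** Modulo the branching elements, all generators are equal and have order
    dividing 4. *)
Lemma branching_deg p : G p -> (4 %| deg p)%Z -> branching p.
Proof.
move=> Gp p4; pose a := gen (Ordinal (leq_trans (isT : 0 < 3) d_ge3)).
have Ga : G a by apply: gen_in_G.
have D4 m : branching (a ^+ (4 * m)).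
  rewrite expgnA; elim: m => [|m IHm].
    by have := branch_cong_refl 1; rewrite /branch_cong mulgV.
  by rewrite expgS; apply: branchingM => //; apply: branching_gen4.
suff [n pn [k en]] : exists2 n, branch_cong p (a ^+ n) &
    exists k : int, (deg p = n%:Z + 4 * k)%R.
  have [m em] : exists m, n = (4 * m)%N by exists (n %/ 4)%N; lia.
  by have := branchingM pn (D4 m); rewrite -em mulgVK.
elim/G_ind: p / Gp {p4}
  => [|p q Gp Gq [n pn [k ek]] [m qm [l el]]|p Gp [n pn [k ek]]|i].
- by exists 0%N; [apply: branch_cong_refl|exists 0%R; rewrite deg1].
- exists (n + m)%N; first by rewrite expgnDr; apply: branch_congM.
  by exists (k + l)%R; rewrite degM //; lia.
- exists (3 * n)%N; last by exists (- k - n%:Z)%R; rewrite degV //; lia.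
  have Gn := GX n Ga.
  apply: (branch_cong_trans (q := (a ^+ n)^-1)).
    have := branchingJ (branch_cong_sym pn) Gp; rewrite /branch_cong.
    rewrite invgK conjgE.
    have -> // : p^-1 * (a ^+ n * p^-1 * p) = p^-1 * a ^+ n by rewrite mulgVK.
  rewrite /branch_cong -invgM -expgnDr.
  by apply: branchingV; rewrite (_ : 3 * n + n = 4 * n)%N //; lia.
- exists 1%N; first exact: branch_cong_gen.
  by exists 0%R; rewrite deg_gen.
Qed.

Lemma pair_in_G x y p q :
    x != y -> G p -> G q -> (4 %| (deg p + deg q)%R)%Z ->
  G (diag (at2 x p y q)).
Proof.
move=> xy Gp Gq pq4.
have [_ /(_ y) Gy] : branching (p * q).
  by apply: branching_deg; [apply: GM|rewrite degM].
have := GM (pair_inverse xy Gp) Gy; rewrite -(at12 _ xy) diag_at2M mulg1.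
by rewrite mulKg.
Qed.

(** * Rigid level stabilizers *)

Implicit Types u v w : seq 'I_d.

Lemma word_section g u : G g -> exists v h, G h /\ carries g u v h.
Proof.
elim: u g => [|x u IHu] g Gg; first by exists [::], g.
have [y [g' [Gg' gx]]] := G_section x Gg; have [v [h [Gh gu]]] := IHu g' Gg'.
by exists (y :: v), h; split=> //; apply: carries_cat gx gu.
Qed.

(** Along the path to u, all sections but one are trivial, and the sum of the
    degrees of the sections doubles at each level. *)
Lemma deg_supported u g h :
    G g -> carries g u u h -> (forall w, ~~ prefix u w -> g w = w) ->
  (deg h = 2 ^+ size u * deg g)%R.
Proof.
elim: u g => [|x u IHu] g Gg gu fix_g.
  by have [_ ->] := carries_fun gu (carries_self g); rewrite mul1r.
have [y [g' [Gg' gx]]] := G_section x Gg.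
have yx : y = x by have := gx u; rewrite (carriesE gu) => -[].
rewrite {}yx in gx.
have g'u : carries g' u u h.
  by move=> w; have := gu w; rewrite [g _](gx (u ++ w)) => -[].
rewrite (IHu g') // => [|w uw]; last first.
  have := fix_g (x :: w); rewrite /= eqxx => /(_ uw).
  by rewrite [g _](gx w) => -[].
suff -> : (deg g' = 2 * deg g)%R by rewrite /= exprS; ring.
rewrite -(sum_deg_sections (y := id) (h := at1 x g')) // => [|z].
  rewrite (bigD1 x) //= big1 => [|z zx]; first by rewrite /at1 eqxx addr0.
  by rewrite /at1 (negbTE zx) deg1.
rewrite /at1; have [->//|zx] := eqVneq z x.
by move=> w; apply: fix_g => /=; rewrite eq_sym (negbTE zx).
Qed.

Lemma vertex_branching u h :
    G h -> ((2 ^+ (size u).+1)%R %| deg h)%Z ->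
  exists2 g, G g & carries g u u h /\ forall w, ~~ prefix u w -> g w = w.
Proof.
elim: u => [|x u IHu] Gh h2.
  by exists h => //; split=> [|w]; [apply: carries_self|rewrite prefix0s].
have [|g Gg [gu fix_g]] := IHu Gh.
  by apply: dvdz_trans h2; rewrite /= [(2 ^+ (size u).+2)%R]exprS dvdz_mull.
have [_ /(_ x) Gx] : branching g.
  apply: branching_deg => //; move: h2; rewrite (deg_supported Gg gu fix_g) /=.
  by rewrite -[(size u).+2]addn2 exprD dvdz_mul2l // expf_neq0.
have gx := diag_carries (at1 x g) x; rewrite [at1 x g x]/at1 eqxx in gx.
exists (diag (at1 x g)) => //; split; first exact: carries_cat gx gu.
case=> [//|y w] /=; rewrite /at1; case: (y =P x) => [->|//].
by rewrite eqxx => /fix_g ->.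
Qed.

(** The invariant that detects the rigid level stabilizers inside the level
    stabilizers. *)
Definition divisible_sections k g : Prop :=
  forall u, size u = k -> exists h,
    [/\ G h, carries g u u h & ((2 ^+ k.+1)%R %| deg h)%Z].

Lemma divisible_sectionsM k g g' :
  divisible_sections k g -> divisible_sections k g' ->
  divisible_sections k (g * g').
Proof.
move=> gk gk' u su; have [h [Gh gu h2]] := gk u su.
have [h' [Gh' gu' h2']] := gk' u su; exists (h * h'); split; first exact: GM.
  exact: carriesM gu gu'.
by rewrite degM // rpredD.
Qed.

Lemma divisible_sectionsV k g :
  divisible_sections k g -> divisible_sections k g^-1.
Proof.
move=> gk u su; have [h [Gh gu h2]] := gk u su; exists h^-1.
by split; [apply: GV|apply: carriesV|rewrite degV // rpredN].
Qed.

Lemma valG (g : group_of (G_ d)) : G (val g).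
Proof. by apply: set_mem; apply: group_valP. Qed.

(** For u at level k + 1, an element of Rist(u) has at u a section of degree
    2^(k+1) times its own, which is even because it fixes the first level. *)
Lemma Rist_level_divisible k (g : group_of (G_ d)) :
  sgset (Rist_level (G_ d) k.+1) g -> divisible_sections k.+1 (val g).
Proof.
move: g; apply: smallest_sub.
  split=> [u _|x y|x] /=.
  - by exists 1; split; [apply: G1|apply: carries1|rewrite deg1 dvdz0].
  - exact: divisible_sectionsM.
  - exact: divisible_sectionsV.
move=> g [u su gu] v sv; rewrite /= in su.
have gS : sgset (St (G_ d) k.+1) g.
  by apply: Rist_level_sub_St; apply: sub_gen_smallest; exists u.
have [vu|vu] := eqVneq v u; last first.
  exists 1; split; [exact: G1| |by rewrite deg1 dvdz0].
  move=> w; apply: gu; apply: contra vu => /prefixP[t].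
  by move/eqP; rewrite eqseq_cat ?sv ?su // => /andP[].
rewrite {v}vu in sv *; have [v [h [Gh guv]]] := word_section u (valG g).
have vu : v = u by rewrite -(carriesE guv); apply: gS.
rewrite {}vu in guv.
exists h; split=> //; rewrite (deg_supported (valG g) guv) // su
  [(2 ^+ k.+2)%R]exprSr.
rewrite dvdz_mul ?dvdzz //; apply: deg_even; first exact: valG.
move=> x; have : sgset (St (G_ d) (1 + k)) g by [].
by move/St_anti => g1; apply: g1.
Qed.

(** The condition on the degrees is the one under which each section, placed
    alone at its vertex, is an element of the group. *)
Lemma divisible_Rist_level k (g : group_of (G_ d)) :
  divisible_sections k (val g) -> sgset (Rist_level (G_ d) k) g.
Proof.
have [R1 RM _] := generated_subgroup
  (\bigcup_(u in [set u | size u = k]) Rist_set (G := G_ d) u)%classic.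
(* the sections at the vertices listed in s are removed one by one *)
suff clear_vertices (s : seq (seq 'I_d)) (f : group_of (G_ d)) :
    divisible_sections k (val f) ->
    (forall u, size u = k -> u \notin s -> carries (val f) u u 1) ->
    sgset (Rist_level (G_ d) k) f.
  move=> gk; pose s := [seq tval t | t <- enum {: k.-tuple 'I_d}].
  apply: (clear_vertices s g gk) => u /eqP su /negP[]; apply/mapP.
  by exists (Tuple su) => //; rewrite mem_enum.
elim: s f => [|u s IHs] f fk f_out.
  suff -> : f = 1 by [].
  apply: val_inj; apply: aut_ext => w /=.
  have [kw|wk] := leqP k (size w).
    rewrite -(cat_take_drop k w) (f_out (take k w)) //.
    by rewrite size_takel.
  have : sgset (St (G_ d) (size w + (k - size w))) f.
    by rewrite subnKC ?(ltnW wk) // => v sv; apply: (carriesE (f_out v sv isT)).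
  by move/St_anti => fw; apply: fw.
have [su|su] := eqVneq (size u) k; last first.
  apply: IHs => // v sv vs; apply: f_out => //.
  by rewrite inE negb_or vs andbT; apply: contra su => /eqP <-; apply/eqP.
have [h [Gh fu h2]] := fk u su.
have [|g0 Gg0 [g0u fix_g0]] := vertex_branching (u := u) Gh.
  by rewrite su.
pose g1 : group_of (G_ d) := GroupOf (mem_set Gg0).
have g0_out v : size v = k -> v != u -> carries g0 v v 1.
  move=> sv vu w; apply: fix_g0; apply: contra vu => /prefixP[t].
  by move/eqP; rewrite eqseq_cat ?sv ?su // => /andP[].
have fg v : size v = k -> v != u ->
    forall l, carries (val f) v v l -> carries (val (f * g1^-1)) v v l.
  move=> sv vu l fv; rewrite -[l]mulg1 -invg1.
  exact: carriesM fv (carriesV (g0_out v sv vu)).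
have fgu : carries (val (f * g1^-1)) u u 1.
  rewrite -(mulgV h); exact: carriesM fu (carriesV g0u).
rewrite -(mulgVK g1 f); apply: RM.
  apply: IHs => v sv.
    have [->|vu] := eqVneq v u.
      by exists 1; split=> //; [apply: G1|rewrite deg1 dvdz0].
    by have [l [Gl fv l2]] := fk v sv; exists l; split=> //; apply: fg.
  move=> vs; have [->//|vu] := eqVneq v u.
  by apply: fg => //; apply: f_out => //; rewrite inE negb_or vu.
by apply: sub_gen_smallest; exists u.
Qed.

(** * Elements of the rigid kernel *)

Section KernelElement.
Local Open Scope quotient_scope.
Variables (o : 'I_d) (m : nat).
Hypothesis m_le2 : m <= 2.
Let o' := ordS o.

Let oo' : o != o'. Proof. by rewrite eq_sym ordS_neq. Qed.

(** Elements of degree 2 that split, j levels below, into powers of the square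
    of a generator: m = 1 shares the degree between two children of a vertex,
    m = 2 concentrates it on one. *)
Fixpoint spread j : Aut_tree d :=
  if j is j'.+1 then diag (at2 o (spread j' ^+ m) o' (spread j' ^+ (2 - m)))
  else gen o ^+ 2.

Fixpoint coef (u : seq 'I_d) : nat :=
  if u is x :: v then
    coef v * (if x == o then m else if x == o' then 2 - m else 0)
  else 1.

Lemma spread_deg j : G (spread j) /\ (deg (spread j) = 2)%R.
Proof.
elim: j => [|j [Gj dj]].
  by have Go := gen_in_G o; split; [apply: GX|rewrite degX // deg_gen].
have GX' n := GX n Gj.
have Gj1 : G (spread j.+1).
  by apply: pair_in_G => //; rewrite !degX // dj; lia.
split=> //.
have := sum_deg_sections Gj1 (diag_carries _).
rewrite (bigD1 o) //= (bigD1 o') 1?eq_sym //=.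
rewrite big1 => [|x /andP[xo xo']]; last first.
  by rewrite /at2 (negbTE xo) (negbTE xo') deg1.
rewrite /at2 !eqxx (eq_sym o') (negbTE oo') !degX // dj; lia.
Qed.

Lemma spread_carries n u :
  carries (spread (size u + n)) u u (spread n ^+ coef u).
Proof.
elim: u => [|x u IHu] //=.
apply: (carries_cat (u := [:: x]) (v := [:: x])); first exact: diag_carries.
rewrite expgnA /at2; do 2?[case: ifP => _]; try exact: carriesX.
exact: carries1.
Qed.

Definition kernel_rep j : Aut_tree d :=
  diag (at2 o (spread j) o' (spread j)^-1).

Definition kernel_section n x u : Aut_tree d :=
  if x == o then spread n ^+ coef u
  else if x == o' then (spread n ^+ coef u)^-1 else 1.

Lemma kernel_rep_carries n x u :
  carries (kernel_rep (size u + n)) (x :: u) (x :: u) (kernel_section n x u).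
Proof.
apply: (carries_cat (u := [:: x]) (v := [:: x])); first exact: diag_carries.
rewrite /at2 /kernel_section; case: ifP => _; first exact: spread_carries.
case: ifP => _; last exact: carries1.
exact/carriesV/spread_carries.
Qed.

Lemma kernel_rep_in_G j : G (kernel_rep j).
Proof. by apply: pair_inverse => //; have [] := spread_deg j. Qed.

Lemma kernel_section_in_G n x u : G (kernel_section n x u).
Proof.
have [Gi _] := spread_deg n; have Gu := GX (coef u) Gi.
rewrite /kernel_section; case: ifP => // _; case: ifP => _; last exact: G1.
exact: GV.
Qed.

Lemma deg_kernel_section n x u :
  (deg (kernel_section n x u) =
   (if x == o then 1 else if x == o' then -1 else 0) * ((coef u)%:Z * 2))%R.
Proof.
have [Gi di] := spread_deg n; have GX' := GX (coef u) Gi.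
rewrite /kernel_section.
by do 2?[case: ifP => _]; rewrite ?deg1 ?degV ?degX ?di //; lia.
Qed.

Definition kernel_rep_of j : group_of (G_ d) :=
  GroupOf (mem_set (kernel_rep_in_G j)).

(** The two representatives have at level j + 1 powers, of the same exponent, of
    two elements of degree 2. *)
Lemma kernel_rep_coherent j p :
  sgset (Rist_level (G_ d) j.+1) ((kernel_rep_of (j + p))^-1 * kernel_rep_of j).
Proof.
apply: divisible_Rist_level => -[//|x u] [su].
exists ((kernel_section p x u)^-1 * kernel_section 0 x u); split.
- by apply: GM; [apply: GV|]; apply: kernel_section_in_G.
- apply: carriesM; [apply: carriesV|rewrite -[j]addn0]; rewrite -su;
    exact: kernel_rep_carries.
- rewrite degM ?degV ?deg_kernel_section;
    do ?[apply: GV | apply: kernel_section_in_G].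
  by rewrite addNr dvdz0.
Qed.

Lemma kernel_elt_subproof k p :
  quotient_map (Rist_chain (G_ d) k)
    (\pi_(quotient_group (Rist_chain (G_ d) (k + p))) (kernel_rep_of (k + p))) =
  \pi_(quotient_group (Rist_chain (G_ d) k)) (kernel_rep_of k).
Proof.
rewrite quotient_mapE; last exact: chainP.
by apply/quotientP; apply: kernel_rep_coherent.
Qed.

Definition kernel_elt : invlim (Rist_chain (G_ d)) :=
  InvLim kernel_elt_subproof.

Lemma kernel_elt_in_kernel : rigid_kernel (G_ d) kernel_elt.
Proof.
apply: invlim_ext => k /=; rewrite quotient_mapE; last exact: Rist_level_sub_St.
apply/quotientP; rewrite mulg1.
have [_ _ SV] := St_subgroup (G_ d) k.+1.
apply: SV => -[//|x u] [su].
apply: (carriesE (h := kernel_section 0 x u)).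
rewrite /= -[k]addn0 -su; exact: kernel_rep_carries.
Qed.

Lemma kernel_eltX n k :
  (kernel_elt ^+ n) k =
  \pi_(quotient_group (Rist_chain (G_ d) k)) (kernel_rep_of k ^+ n).
Proof.
elim: n => [//|n IHn].
by rewrite !expgS piM -IHn.
Qed.

Lemma kernel_eltX_eq1 n :
  kernel_elt ^+ n = 1 <-> forall k, divisible_sections k.+1 (kernel_rep k ^+ n).
Proof.
have valX k : val (kernel_rep_of k ^+ n) = kernel_rep k ^+ n.
  by elim: n => // n IHn; rewrite !expgS -IHn.
split=> [e k|div].
  rewrite -valX; apply: Rist_level_divisible.
  have : (kernel_elt ^+ n) k = 1 by rewrite e.
  rewrite kernel_eltX => /esym/quotientP.
  by rewrite invg1 mul1g.
apply: invlim_ext => k; rewrite kernel_eltX; apply/esym/quotientP.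
by rewrite invg1 mul1g; apply: divisible_Rist_level; rewrite valX.
Qed.

(** At the vertex o ... o of level k + 1, the representative of the element has
    a section of degree 2 m^k. *)
Lemma kernel_eltX_deg n k :
  kernel_elt ^+ n = 1 -> (2 ^ k.+2 %| n * (m ^ k * 2))%N.
Proof.
move=> /kernel_eltX_eq1/(_ k) /(_ (o :: nseq k o)).
rewrite /= size_nseq => /(_ erefl) [h [Gh hk h2]].
have := @kernel_rep_carries 0 o (nseq k o); rewrite size_nseq addn0.
move/(carriesX n)/carries_fun => /(_ _ _ hk) [_ eh].
move: h2; rewrite -{h Gh hk}eh.
rewrite degX ?deg_kernel_section ?eqxx; last exact: kernel_section_in_G.
have -> : coef (nseq k o) = (m ^ k)%N.
  by elim: k => //= k ->; rewrite eqxx expnSr.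
by rewrite mul1r dvdzE abszX -!PoszM !absz_nat.
Qed.

End KernelElement.

Lemma coef2_dvdn o u : (2 ^ size u %| coef o 2 u)%N.
Proof.
elim: u => //= x u IHu; rewrite expnSr.
by case: ifP => _; [apply: dvdn_mul|rewrite if_same muln0].
Qed.

Lemma kernel_elt2_sqr o : kernel_elt o (leqnn 2) ^+ 2 = 1.
Proof.
apply/kernel_eltX_eq1 => k [//|x u] [su].
have Gs := kernel_section_in_G o (leqnn 2) 0 x u.
exists (kernel_section o 2 0 x u ^+ 2); split; first exact: GX.
  by apply: carriesX; rewrite -[k]addn0 -su; apply: kernel_rep_carries.
rewrite degX // deg_kernel_section // mulrCA; apply: dvdz_mull.
have /dvdnP[c ->] := coef2_dvdn o u; rewrite su.
rewrite dvdzE abszX -!PoszM !absz_nat.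
have -> : (2 * (c * 2 ^ k * 2) = c * 2 ^ k.+2)%N by rewrite !expnS; lia.
exact: dvdn_mull.
Qed.

End OddPolygonGroup.

Theorem corollary5p3 (d : nat) (d_ge3 : 3 <= d) (d_odd : odd d) :
  ~ torsion (rigid_kernel (G_ d)) /\ ~ torsion_free (rigid_kernel (G_ d)).
Proof.
pose o : 'I_d := Ordinal (leq_trans (isT : 0 < 3) d_ge3).
split=> [tors|tf].
  pose z := kernel_elt d_ge3 d_odd o (isT : 1 <= 2).
  have [n n0 zn] := tors z (kernel_elt_in_kernel _ _ _ _).
  have /dvdn_leq := kernel_eltX_deg n zn.
  rewrite exp1n => /(_ _); rewrite muln_gt0 n0 => /(_ isT).
  by have := ltn_expl n (ltnSn 1); rewrite !expnS; lia.
pose z := kernel_elt d_ge3 d_odd o (leqnn 2).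
apply: (tf z (kernel_elt_in_kernel _ _ _ _)) (2) _ (kernel_elt2_sqr _ _ _);
  last by [].
move=> z1.
by have := kernel_eltX_deg 0 (n := 1) z1.
Qed.
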